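(* Let $k$ be an algebraically closed field and let $A=kQ/I$ be a finite dimensional (indecomposable) gentle $k$-algebra with graph $\Gamma_A$. Let $B$ be the Brauer graph algebra defined on $\Gamma_A$ with cyclic ordering induced by the maximal paths in $A$ and with multiplicity equal to one at every vertex. Then the trivial extension $T(A)$ of $A$ is isomorphic to $B$, and $G_{T(A)}=\Gamma_A$, where $G_{T(A)}$ is the graph of $T(A)$ as a symmetric special biserial algebra (with the same cyclic orderings of edges at each vertex).
   Context: Paths are composed left to right; $s(\cdot),t(\cdot)$ denote start and end. An algebra is gentle if it is Morita equivalent to $kQ/I$ ($Q$ finite connected, $I$ admissible) with: (S1) each vertex is the start of at most two arrows and the end of at most two arrows; (S2) for each arrow $\alpha$ at most one arrow $\beta$ with $\alpha\beta\notin I$ and at most one arrow $\gamma$ with $\gamma\alpha\notin I$; (S3) $I$ is generated by paths of length 2; (S4) for each arrow $\alpha$ at most one arrow $\delta$ with $\alpha\delta\in I$ and at most one arrow $\varepsilon$ with $\varepsilon\alpha\in I$. Trivial extension: $T(A)=A\ltimes D(A)$, where $D(A)=\mathrm{Hom}_k(A,k)$; as a vector space $A\oplus D(A)$ with $(a,f)(b,g)=(ab,ag+fb)$. Graph $\Gamma_A$: let $\mathcal M$ be the set of nontrivial maximal paths of $(Q,I)$ (paths not in $I$ that cannot be extended by an arrow on either side without lying in $I$). Let $\overline{\mathcal M}$ consist of $\mathcal M$ together with the trivial paths $e_i$ at those vertices $i$ that are a sink with a single incoming arrow, or a source with a single outgoing arrow, or have exactly one incoming arrow $\alpha$ and one outgoing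 arrow $\beta$ with $\alpha\beta\notin I$. Each vertex of $Q$ lies on exactly two elements of $\overline{\mathcal M}$. $\Gamma_A$ has one vertex $\nu(m)$ for each $m\in\overline{\mathcal M}$ and one edge $E_i$ for each vertex $i$ of $Q$, joining $\nu(m_i)$ and $\nu(n_i)$, where $m_i,n_i$ are the two elements of $\overline{\mathcal M}$ through $i$. Cyclic ordering induced by maximal paths: for $m=i_1\to i_2\to\cdots\to i_{n+1}$ in $\mathcal M$, the edges around $\nu(m)$ are ordered $E_{i_1}<E_{i_2}<\dots<E_{i_{n+1}}$ following $m$, closed up cyclically by letting $E_{i_1}$ follow $E_{i_{n+1}}$; a vertex $\nu(e_i)$ has the single edge $E_i$. Brauer graph algebra: for a Brauer graph $\Gamma$ (finite connected graph, loops/multiple edges allowed, with cyclic ordering of edges around each vertex and multiplicities $e(\nu)\ge1$), its quiver has a vertex $i$ per edge $E_i$ and an arrow $i\to j$ when $E_j$ directly follows $E_i$ around a common vertex (a loop at a leaf edge only if the leaf vertex has multiplicity $\ge2$). With $C_{\nu,i}$ the cycle of vertex $\nu$ starting at $i$, relations are $C_{\nu,i}^{e(\nu)}-C_{\nu',i}^{e(\nu')}$ for edges $E_i$ with endpoints $\nu,\nu'$ neither a leaf vertex of multiplicity one; $C_{\nu',i}\alpha$ ($\alpha$ the arrow of $C_{\nu',i}$ from $i$) when $\nu$ is a leaf vertex of multiplicity one; and $\alpha\beta$ for composable arrows on cycles of distinct vertices. Graph $G_\Lambda$ of a symmetric special biserial algebra $\Lambda=kQ/I$: at each vertex $i$ take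 the two maximal cyclic paths at $i$ (the paths $p,q$ with $P_i$ biserial given by $p-q\in I$, or the unique nontrivial maximal path $p$ from $i$ to $i$ together with $e_i$ if $P_i$ is uniserial); the vertices of $G_\Lambda$ are rotation classes of such paths; writing $p=p_0^m$ with $p_0$ a simple cycle through vertices $(i,i_1,\dots,i_k)$, the vertex carries germs labelled $i,i_1,\dots,i_k$ in this cyclic order and multiplicity $m$; the two germs labelled by each vertex $i$ of $Q$ are joined to an edge.
   Formalization: Q is assumed to have at least one arrow (for A = k the graph Γ_A is undefined), and the zero relations αβ of B are taken for all composable arrows where β is not the cyclic successor of α, which also covers edges of Γ_A that are loops. *)

(* Defs.v *)
From HB Require Import structures.
From mathcomp Require Import all_boot all_order all_algebra.
Set Implicit Arguments. Unset Strict Implicit. Unset Printing Implicit Defensive.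
Import GRing.Theory.

(* Quivers.  Paths are composed left to right: a path is a start vertex *)
(* together with a sequence of arrows a1 a2 ... an with t(ai) = s(ai+1). *)
(* [qarr] selects which elements of the arrow type are arrows.          *)
Record quiver := Quiver {
  qV : finType; qA : finType; qarr : pred qA; qs : qA -> qV; qt : qA -> qV }.
Arguments qarr {q} _.
Arguments qs {q} _.
Arguments qt {q} _.

Section Paths.
Variable Q : quiver.

Definition qpath := (qV Q * seq (qA Q))%type.

Definition pvalid (p : qpath) : bool :=
  match p.2 with
  | [::] => true
  | a :: s' => [&& @qs Q a == p.1, path (fun x y => @qt Q x == @qs Q y) a s'
               & all (@qarr Q) p.2]
  end.

Definition ptarget (p : qpath) : qV Q := last p.1 (map (@qt Q) p.2).

(* concatenation in the path algebra; None means the product is zero *)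
Definition pconcat (p q : qpath) : option qpath :=
  if ptarget p == q.1 then Some (p.1, p.2 ++ q.2) else None.

(* Elements of the path algebra kQ: formal linear combinations of paths. *)
Variable k : fieldType.
Definition combo := seq (k * qpath)%type.

Definition coef (x : combo) (p : qpath) : k := (\sum_(c <- x | c.2 == p) c.1)%R.
Definition cvalid (x : combo) : bool := all (fun c => pvalid c.2) x.

Definition mul_pcp (u : qpath) (r : combo) (v : qpath) : combo :=
  flatten [seq match pconcat u c.2 with
               | Some uq => match pconcat uq v with
                            | Some w => [:: (c.1, w)] | None => [::] end
               | None => [::] end | c <- r].

Definition scale_combo (c : k) (x : combo) : combo := [seq ((c * d.1)%R, d.2) | d <- x].

Definition in_ideal (rels : seq combo) (x : combo) : Prop :=
  exists ts : seq (k * qpath * nat * qpath),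
    all (fun t => [&& pvalid t.1.1.2, pvalid t.2 & (t.1.2 < size rels)%N]) ts /\
    forall p, coef x p =
      coef (flatten [seq scale_combo t.1.1.1 (mul_pcp t.1.1.2 (nth [::] rels t.1.2) t.2)
                    | t <- ts]) p.

End Paths.

Record fdalg (k : fieldType) := FDAlg {
  fd_dim : nat;
  fd_mul : 'rV[k]_fd_dim -> 'rV[k]_fd_dim -> 'rV[k]_fd_dim;
  fd_one : 'rV[k]_fd_dim }.
Arguments fd_dim {k} _.
Arguments fd_mul {k} _ _ _.
Arguments fd_one {k} _.

Definition is_fdalg (k : fieldType) (A : fdalg k) : Prop :=
  (forall (c : k) x y z, fd_mul A (c *: x + y) z = c *: fd_mul A x z + fd_mul A y z)%R /\
  (forall (c : k) x y z, fd_mul A z (c *: x + y) = c *: fd_mul A z x + fd_mul A z y)%R /\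
  (forall x y z, fd_mul A (fd_mul A x y) z = fd_mul A x (fd_mul A y z)) /\
  (forall x, fd_mul A (fd_one A) x = x /\ fd_mul A x (fd_one A) = x).

(* the dual pairing D(A) x A -> k, D(A) in the dual-basis coordinates *)
Definition dpair (k : fieldType) (n : nat) (f x : 'rV[k]_n) : k :=
  (\sum_i f ord0 i * x ord0 i)%R.

Section TrivExt.
Variables (k : fieldType) (A : fdalg k).
Local Notation d := (fd_dim A).
Definition act_l (a g : 'rV[k]_d) : 'rV[k]_d :=
  \row_i dpair g (fd_mul A (delta_mx ord0 i) a).
Definition act_r (f b : 'rV[k]_d) : 'rV[k]_d :=
  \row_i dpair f (fd_mul A b (delta_mx ord0 i)).
Definition triv_mul (w w' : 'rV[k]_(d + d)) : 'rV[k]_(d + d) :=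
  row_mx (fd_mul A (lsubmx w) (lsubmx w'))
         (act_l (lsubmx w) (rsubmx w') + act_r (rsubmx w) (lsubmx w'))%R.
Definition TExt : fdalg k := @FDAlg k (d + d) triv_mul (row_mx (fd_one A) 0%R).
End TrivExt.

(* "A is isomorphic to kQ/<rels>": there is a surjective algebra map    *)
(* kQ -> A (determined by images of the trivial paths and arrows) whose  *)
(* kernel is exactly the ideal generated by rels.                        *)
Section Presentation.
Variables (k : fieldType) (A : fdalg k) (Q : quiver).

Definition peval (e : qV Q -> 'rV[k]_(fd_dim A)) (x : qA Q -> 'rV[k]_(fd_dim A))
  (p : qpath Q) : 'rV[k]_(fd_dim A) :=
  match p.2 with
  | [::] => e p.1
  | a :: s' => foldl (fun acc b => fd_mul A acc (x b)) (x a) s'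
  end.

Definition ceval e x (c : combo Q k) : 'rV[k]_(fd_dim A) :=
  (\sum_(t <- c) t.1 *: peval e x t.2)%R.

Definition presents (rels : seq (combo Q k)) : Prop :=
  exists (e : qV Q -> 'rV[k]_(fd_dim A)) (x : qA Q -> 'rV[k]_(fd_dim A)),
    (forall u v, fd_mul A (e u) (e v) = if u == v then e u else 0%R) /\
    (\sum_v e v)%R = fd_one A /\
    (forall a, qarr a -> fd_mul A (e (qs a)) (x a) = x a /\ fd_mul A (x a) (e (qt a)) = x a) /\
    (forall y, exists c, cvalid c /\ ceval e x c = y) /\
    (forall c, cvalid c -> (ceval e x c = 0%R <-> in_ideal rels c)).
End Presentation.

(* Gentle bound quivers (Q, I), I generated by the paths ab with rel a b *)
Section Gentle.
Variables (V Arr : finType) (s t : Arr -> V) (rel : Arr -> Arr -> bool).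

Definition gquiver : quiver := @Quiver V Arr predT s t.

Definition qconnected (Q : quiver) : Prop :=
  forall u v : qV Q,
    connect (fun x y => [exists a, ((qs a == x) && (qt a == y)) || ((qs a == y) && (qt a == x))]) u v.

Definition gentle : Prop :=
  (forall a b, rel a b -> t a = s b) /\
  (forall v, #|[set a | s a == v]| <= 2 /\ #|[set a | t a == v]| <= 2) /\
  (forall a, #|[set b | (t a == s b) && ~~ rel a b]| <= 1 /\
             #|[set c | (t c == s a) && ~~ rel c a]| <= 1) /\
  (forall a, #|[set b | rel a b]| <= 1 /\ #|[set c | rel c a]| <= 1).

Definition has_rel (p : qpath gquiver) : bool :=
  match p.2 with [::] => false | a :: s' => ~~ path (fun x y => ~~ rel x y) a s' end.

(* admissibility: J^N is contained in I for some N (I in J^2 is automatic) *)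
Definition admissible : Prop :=
  exists N, forall p : qpath gquiver, pvalid p -> N <= size p.2 -> has_rel p.

Definition gentle_rels (k : fieldType) : seq (combo gquiver k) :=
  [seq [:: (1%R, (s ab.1, [:: ab.1; ab.2]) : qpath gquiver)]
  | ab <- enum [pred ab : Arr * Arr | rel ab.1 ab.2]].

(* ---- the graph Gamma_A, via half-edges ("germs").  A germ at vertex i is
   an occurrence of i on an element of \bar M, recorded by the arrow of the
   maximal path entering i and the one leaving i (None if there is none);
   (i, None, None) is the trivial path e_i. *)
Definition trivial_ok (i : V) : bool :=
  let ins := [set a | t a == i] in let outs := [set a | s a == i] in
  [|| (#|outs| == 0) && (#|ins| == 1), (#|ins| == 0) && (#|outs| == 1)
    | [&& #|ins| == 1, #|outs| == 1 &
         [forall a, forall b, ((t a == i) && (s b == i)) ==> ~~ rel a b]]].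

Definition germ_ok (g : V * option Arr * option Arr) : bool :=
  let: (i, oi, oo) := g in
  match oi, oo with
  | Some a, Some b => [&& t a == i, s b == i & ~~ rel a b]
  | Some a, None => (t a == i) && [forall b, (s b == i) ==> rel a b]
  | None, Some b => (s b == i) && [forall c, (t c == i) ==> rel c b]
  | None, None => trivial_ok i
  end.

Definition germ := {g : V * option Arr * option Arr | germ_ok g}.
Definition gv (g : germ) : V := (val g).1.1.
Definition gin (g : germ) : option Arr := (val g).1.2.
Definition gout (g : germ) : option Arr := (val g).2.

Definition fstep (g g' : germ) : bool :=
  match gout g, gin g' with Some b, Some b' => b == b' | _, _ => false end.

(* cyclic successor around nu(m): next occurrence on m, or from the end of m
   back to its start *)
Definition sigmaRel (g g' : germ) : bool :=
  fstep g g' || [&& gout g == None, gin g' == None & connect fstep g' g].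

Definition sigmaG (g : germ) : germ := odflt g [pick g' | sigmaRel g g'].

End Gentle.

(* Brauer graphs via half-edges: bedge gives the edge of a half-edge,    *)
(* bsig the next half-edge in the cyclic order around its vertex         *)
(* (vertices = bsig-orbits), bmult the multiplicity of its vertex.       *)
Record bgraph := BGraph {
  bE : finType; bH : finType; bedge : bH -> bE; bsig : bH -> bH; bmult : bH -> nat }.
Arguments bedge {b} _.
Arguments bsig {b} _.
Arguments bmult {b} _.

Definition GammaA (V Arr : finType) (s t : Arr -> V) (rel : Arr -> Arr -> bool) : bgraph :=
  @BGraph V (germ s t rel) (@gv V Arr s t rel) (sigmaG (s:=s) (t:=t) (rel:=rel)) (fun _ => 1%N).

Section Brauer.
Variable G : bgraph.

Definition btrunc (h : bH G) : bool := (bsig h == h) && (bmult h == 1%N).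

Definition bquiver : quiver :=
  @Quiver (bE G) (bH G) (fun h => ~~ btrunc h) (@bedge G) (fun h => bedge (bsig h)).

Definition bcyc (h : bH G) : seq (bH G) := traject (@bsig G) h (order (@bsig G) h).
Definition bcycpow (h : bH G) : seq (bH G) := flatten (nseq (bmult h) (bcyc h)).

Variable k : fieldType.
Definition brels : seq (combo bquiver k) :=
  [seq [:: (1%R, (bedge hh.1, bcycpow hh.1) : qpath bquiver);
           ((-1)%R, (bedge hh.2, bcycpow hh.2))]
  | hh <- enum [pred hh : bH G * bH G |
       [&& hh.1 != hh.2, bedge hh.1 == bedge hh.2, ~~ btrunc hh.1 & ~~ btrunc hh.2]]]
  ++
  [seq [:: (1%R, (bedge hh.2, bcycpow hh.2 ++ [:: hh.2]) : qpath bquiver)]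
  | hh <- enum [pred hh : bH G * bH G |
       [&& hh.1 != hh.2, bedge hh.1 == bedge hh.2, btrunc hh.1 & ~~ btrunc hh.2]]]
  ++
  [seq [:: (1%R, (bedge hh.1, [:: hh.1; hh.2]) : qpath bquiver)]
  | hh <- enum [pred hh : bH G * bH G |
       [&& ~~ btrunc hh.1, ~~ btrunc hh.2, bedge (bsig hh.1) == bedge hh.2
         & hh.2 != bsig hh.1]]].
End Brauer.

(* The graph G_Lambda of Lambda = kQ/<rels> (symmetric special biserial), *)
(* in half-edge form: half-edges at vertex i are the two maximal cyclic  *)
(* paths at i; the successor of a half-edge is the rotation by one arrow. *)
Section GLambda.
Variables (k : fieldType) (Q : quiver) (rels : seq (combo Q k)).

Definition zero_path (p : qpath Q) : Prop := in_ideal rels [:: (1%R, p)].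

Definition maxcyc (i : qV Q) (c : qpath Q) : Prop :=
  [/\ c.1 = i, c.2 != [::], pvalid c, ptarget c = i & ~ zero_path c] /\
  (forall a, qarr a -> qs a = i -> zero_path (i, c.2 ++ [:: a])) /\
  (forall a, qarr a -> qt a = i -> zero_path (qs a, a :: c.2)).

Definition lgerm (i : qV Q) (c : qpath Q) : Prop :=
  maxcyc i c \/
  (c = (i, [::]) /\ exists p, maxcyc i p /\ forall q, maxcyc i q -> q = p).

Definition rot1 (c : qpath Q) : qpath Q :=
  match c.2 with [::] => c | a :: s' => (qt a, s' ++ [:: a]) end.

Definition rperiod (T : eqType) (s : seq T) : nat :=
  (find (fun r => rot r.+1 s == s) (iota 0 (size s))).+1.

(* p = p0^m with p0 primitive: m = length / rotation period *)
Definition gmult (c : qpath Q) : nat :=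
  if c.2 is [::] then 1%N else (size c.2 %/ rperiod c.2)%N.
End GLambda.

Definition G_equals (k : fieldType) (G : bgraph) (rels : seq (combo (bquiver G) k)) : Prop :=
  exists f : bH G -> qpath (bquiver G),
    [/\ injective f,
        (forall h, (f h).1 = bedge h /\ lgerm rels (bedge h) (f h)),
        (forall i c, lgerm rels i c -> exists h, f h = c),
        (forall h, f (bsig h) = rot1 (f h)) &
        (forall h, bmult h = gmult (f h))].

(* Main.v *)
Require Import Defs.
From mathcomp Require Import all_boot all_order all_algebra.
(** The form [(a, f) |-> f 1] on [T(A)] is nondegenerate.  Send an arrow of the Brauer quiver
    that continues a maximal path to the corresponding arrow of [A], and the arrow that closes
    up the maximal path [m] to the element [m^*] of [D(A)] dual to [m].  The form then takes
    the value 1 on the image of a path if that path is a full cycle around a vertex of the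
    Brauer graph, and 0 otherwise.  By nondegeneracy this determines all linear relations
    between images of paths, and these are exactly the Brauer graph relations: a path that is
    no subpath of a cycle is 0, and two full cycles at the same vertex agree.  The maximal
    cyclic paths are therefore the full cycles, one for each half-edge. *)
Set Implicit Arguments. Unset Strict Implicit. Unset Printing Implicit Defensive.
Import GRing.Theory.
Local Open Scope ring_scope.

(** * Paths, ideals and evaluation *)

(** No dimension count is made; both halves of the isomorphism rest on complements in cycles. A path
    that does not vanish completes to a full cycle, and the first arrow of a full cycle determines
    all of it, so a nonempty complement pairs to 1 with that path and to 0 with every other path of
    the kind considered. Applied to a path [p] of the gentle quiver, the complement maps onto the
    dual element of [p], which gives surjectivity. Applied to normal forms modulo the Brauer
    relations, the complements are a dual family, which gives injectivity. The arrows of the Brauer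
    quiver are half-edges: a germ with outgoing arrow [b] stands for [b], and a nontrivial germ
    without one closes up a maximal path. Admissibility makes each cycle contain exactly one closing
    arrow. Since [D(A)] has square zero, only paths with a single closing arrow can have a nonzero
    value under the form. *)

Lemma not_path_split (T : Type) (R : rel T) a s :
  ~~ path R a s -> exists u x y v, a :: s = u ++ x :: y :: v /\ ~~ R x y.
Proof.
elim: s a => //= b s IH a; rewrite negb_and => /orP[nR|/IH].
  by exists [::], a, b, s.
by case=> u [x [y [v [E nR]]]]; exists (a :: u), x, y, v; rewrite E.
Qed.

Section QuiverPaths.
Variable Q : quiver.
Implicit Types (p q : qpath Q) (u v : seq (qA Q)) (i : qV Q).

Lemma pvalid_cons i a u :
  pvalid (Q := Q) (i, a :: u) = [&& qs a == i, qarr a & pvalid (Q := Q) (qt a, u)].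
Proof.
rewrite /pvalid /=; case: u => [|b u] /=; rewrite ?andbT //.
rewrite [qs b == qt a]eq_sym.
by case: (qs a == i); case: (qarr a); case: (qt a == qs b); rewrite ?andbF ?andbT.
Qed.

Lemma pvalid_cat i u v :
  pvalid (Q := Q) (i, u ++ v) =
  pvalid (Q := Q) (i, u) && pvalid (Q := Q) (ptarget (Q := Q) (i, u), v).
Proof. by elim: u i => [|a u IH] i //; rewrite cat_cons !pvalid_cons IH !andbA. Qed.

Lemma ptarget_cat i u v :
  ptarget (Q := Q) (i, u ++ v) = ptarget (Q := Q) (ptarget (Q := Q) (i, u), v).
Proof. by rewrite /ptarget /= map_cat last_cat. Qed.

(** * Linear combinations of paths and the ideals they generate *)

Section Combos.
Variable k : fieldType.
Implicit Types (x y : combo Q k) (c : k) (rels : seq (combo Q k)).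

Lemma combo_coef_cat x y p : coef (x ++ y) p = coef x p + coef y p.
Proof. by rewrite /coef big_cat. Qed.

Lemma combo_coef_cons c q x p : coef ((c, q) :: x) p = (if q == p then c else 0) + coef x p.
Proof. by rewrite /coef big_cons /=; case: ifP; rewrite ?add0r. Qed.

Lemma combo_coef_scale c x p : coef (scale_combo c x) p = c * coef x p.
Proof. by rewrite /coef big_map mulr_sumr. Qed.

Lemma combo_coef_flatten (T : Type) (F : T -> combo Q k) ts p :
  coef (flatten [seq F t | t <- ts]) p = \sum_(t <- ts) coef (F t) p.
Proof. by rewrite /coef big_flatten big_map. Qed.

Lemma combo_coef1 c q p : coef [:: (c, q)] p = if q == p then c else 0.
Proof. by rewrite /coef big_cons big_nil /= addr0; case: ifP. Qed.

(** Ideal membership is phrased through [coef], evaluation through the list of terms; collecting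
    equal paths links the two. *)
Lemma combo_sum_coef (W : lmodType k) (phi : qpath Q -> W) x (S : seq (qpath Q)) :
  uniq S -> {subset [seq t.2 | t <- x] <= S} ->
  \sum_(t <- x) t.1 *: phi t.2 = \sum_(p <- S) coef x p *: phi p.
Proof.
move=> uS sub; under [RHS]eq_bigr => p do rewrite /coef scaler_suml.
rewrite (exchange_big_dep xpredT) //= big_seq [RHS]big_seq.
apply: eq_bigr => t tx; have tS : t.2 \in S by apply: sub; apply: map_f.
rewrite -big_filter; have -> : [seq p <- S | t.2 == p] = [:: t.2].
  by rewrite -(filter_pred1_uniq uS tS); apply: eq_filter => p /=; rewrite eq_sym.
by rewrite big_seq1.
Qed.

Lemma combo_sum_eq (W : lmodType k) (phi : qpath Q -> W) x y :
  (forall p, coef x p = coef y p) ->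
  \sum_(t <- x) t.1 *: phi t.2 = \sum_(t <- y) t.1 *: phi t.2.
Proof.
move=> E; pose S := undup ([seq t.2 | t <- x] ++ [seq t.2 | t <- y]).
rewrite !(@combo_sum_coef _ phi _ S) ?undup_uniq //.
- by apply: eq_bigr => p _; rewrite E.
- by move=> p py; rewrite mem_undup mem_cat py orbT.
- by move=> p px; rewrite mem_undup mem_cat px.
Qed.

Lemma in_ideal_eq rels x y :
  (forall p, coef x p = coef y p) -> in_ideal rels x -> in_ideal rels y.
Proof. by move=> E [ts [hts H]]; exists ts; split=> // p; rewrite -E. Qed.

Lemma in_ideal0 rels x : (forall p, coef x p = 0) -> in_ideal rels x.
Proof. by move=> E; exists [::]; split=> // p; rewrite E /= /coef big_nil. Qed.

Lemma in_ideal_cat rels x y : in_ideal rels x -> in_ideal rels y -> in_ideal rels (x ++ y).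
Proof.
move=> [ts [hts H]] [ts' [hts' H']]; exists (ts ++ ts'); split; first by rewrite all_cat hts.
by move=> p; rewrite combo_coef_cat map_cat flatten_cat combo_coef_cat H H'.
Qed.

Lemma in_ideal_scale rels c x : in_ideal rels x -> in_ideal rels (scale_combo c x).
Proof.
move=> [ts [hts H]]; exists [seq ((c * t.1.1.1, t.1.1.2), t.1.2, t.2) | t <- ts]; split.
  by rewrite all_map.
move=> p; rewrite combo_coef_scale H -map_comp !combo_coef_flatten mulr_sumr.
by apply: eq_bigr => t _; rewrite /= !combo_coef_scale mulrA.
Qed.

Lemma in_ideal_gen rels r p q :
  pvalid p -> pvalid q -> r \in rels -> in_ideal rels (mul_pcp p r q).
Proof.
move=> vp vq rr; exists [:: (1, p, index r rels, q)]; split.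
  by rewrite /= vp vq index_mem rr.
move=> z; rewrite /= cats0 nth_index // combo_coef_scale mul1r //.
Qed.

Lemma mul_pcp_cons p c w x q :
  mul_pcp p ((c, w) :: x) q =
  (if (ptarget p == w.1) && (ptarget w == q.1)
   then [:: (c, (p.1, p.2 ++ w.2 ++ q.2))] else [::]) ++ mul_pcp p x q.
Proof.
rewrite /mul_pcp /= /pconcat; congr (_ ++ _).
case: eqP => //= E; rewrite catA /=.
rewrite [ptarget (p.1, _)](ptarget_cat p.1) -surjective_pairing E.
by rewrite -surjective_pairing; case: eqP.
Qed.

Lemma in_ideal_monomial rels i u w v :
  [:: (1, w)] \in rels -> pvalid (i, u ++ w.2 ++ v) ->
  ptarget (Q := Q) (i, u) = w.1 -> in_ideal rels [:: (1, (i, u ++ w.2 ++ v))].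
Proof.
move=> rr; rewrite !pvalid_cat => /and3P[vu vw vv] E.
have := @in_ideal_gen rels _ (i, u) (ptarget w, v) vu _ rr.
rewrite mul_pcp_cons /= E !eqxx /= /mul_pcp /=; apply.
by move: vv; rewrite E -surjective_pairing.
Qed.

End Combos.
End QuiverPaths.

(** * Algebras in coordinates and evaluation of paths *)

Section FdAlg.
Variables (k : fieldType) (A : fdalg k).
Hypothesis algA : is_fdalg A.
Local Notation d := (fd_dim A).
Implicit Types a b c : 'rV[k]_d.

Lemma fd_mulA a b c : fd_mul A a (fd_mul A b c) = fd_mul A (fd_mul A a b) c.
Proof. by case: algA => _ [_ [-> _]]. Qed.
Lemma fd_mul1l a : fd_mul A (fd_one A) a = a.
Proof. by case: algA => _ [_ [_ H]]; case: (H a). Qed.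
Lemma fd_mul1r a : fd_mul A a (fd_one A) = a.
Proof. by case: algA => _ [_ [_ H]]; case: (H a). Qed.
Lemma fd_mulDl a b c : fd_mul A (a + b) c = fd_mul A a c + fd_mul A b c.
Proof. by case: algA => H _; have := H 1 a b c; rewrite !scale1r. Qed.
Lemma fd_mulDr a b c : fd_mul A c (a + b) = fd_mul A c a + fd_mul A c b.
Proof. by case: algA => _ [H _]; have := H 1 a b c; rewrite !scale1r. Qed.
Lemma fd_mul0l c : fd_mul A 0 c = 0.
Proof. by apply: (addrI (fd_mul A 0 c)); rewrite -fd_mulDl !addr0. Qed.
Lemma fd_mul0r c : fd_mul A c 0 = 0.
Proof. by apply: (addrI (fd_mul A c 0)); rewrite -fd_mulDr !addr0. Qed.
Lemma fd_mulZl l a c : fd_mul A (l *: a) c = l *: fd_mul A a c.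
Proof. by case: algA => H _; have := H l a 0 c; rewrite fd_mul0l !addr0. Qed.
Lemma fd_mulZr l a c : fd_mul A c (l *: a) = l *: fd_mul A c a.
Proof. by case: algA => _ [H _]; have := H l a 0 c; rewrite fd_mul0r !addr0. Qed.
Lemma fd_mul_suml (I : Type) (r : seq I) (P : pred I) (F : I -> 'rV[k]_d) c :
  fd_mul A (\sum_(i <- r | P i) F i) c = \sum_(i <- r | P i) fd_mul A (F i) c.
Proof.
exact: (big_morph (fun a => fd_mul A a c) (fun a b => fd_mulDl a b c) (fd_mul0l c)).
Qed.
Lemma fd_mul_sumr (I : Type) (r : seq I) (P : pred I) (F : I -> 'rV[k]_d) c :
  fd_mul A c (\sum_(i <- r | P i) F i) = \sum_(i <- r | P i) fd_mul A c (F i).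
Proof.
exact: (big_morph (fun a => fd_mul A c a) (fun a b => fd_mulDr a b c) (fd_mul0r c)).
Qed.

Section Evaluation.
Variables (Q : quiver) (e : qV Q -> 'rV[k]_d) (x : qA Q -> 'rV[k]_d).
Hypothesis idemE : forall u v, fd_mul A (e u) (e v) = if u == v then e u else 0.
Hypothesis arrE : forall a : qA Q, qarr a ->
  fd_mul A (e (qs a)) (x a) = x a /\ fd_mul A (x a) (e (qt a)) = x a.
Implicit Types (p q : qpath Q) (i : qV Q).

(** [peval] nests products to the left, while inductions peel off the first arrow. The condition on
    [acc] is for the empty path, whose value is [e i] and not the unit. *)
Lemma peval_foldl (acc : 'rV[k]_d) i u :
  pvalid (Q := Q) (i, u) -> fd_mul A acc (e i) = acc ->
  foldl (fun acc (b : qA Q) => fd_mul A acc (x b)) acc u =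
  fd_mul A acc (peval e x (i, u)).
Proof.
elim: u acc i => [|b u IH] acc i //=.
rewrite pvalid_cons => /and3P[/eqP <- /arrE[E1 E2] vu] H.
by rewrite (IH _ (qt b)) // -?fd_mulA ?E2 // {2}/peval /= (IH _ (qt b)).
Qed.

Lemma peval_cons i (a : qA Q) u : pvalid (Q := Q) (i, a :: u) ->
  peval e x (i, a :: u) = fd_mul A (x a) (peval e x (qt a, u)).
Proof.
rewrite pvalid_cons => /and3P[/eqP <- /arrE[E1 E2] vu].
by rewrite {1}/peval /= (@peval_foldl _ (qt a)).
Qed.

Lemma peval_start p : pvalid p -> fd_mul A (e p.1) (peval e x p) = peval e x p.
Proof.
case: p => i [|a u] /=; first by rewrite idemE eqxx.
move=> v; rewrite peval_cons // fd_mulA.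
by move: v; rewrite pvalid_cons => /and3P[/eqP <- /arrE[-> _] _].
Qed.

Lemma peval_end p : pvalid p -> fd_mul A (peval e x p) (e (ptarget p)) = peval e x p.
Proof.
case: p => i u; elim: u i => [|a u IH] i; first by rewrite idemE eqxx.
move=> v; rewrite peval_cons // -fd_mulA; congr fd_mul; apply: IH.
by move: v; rewrite pvalid_cons => /and3P[].
Qed.

Lemma peval_mul p q : pvalid p -> pvalid q ->
  fd_mul A (peval e x p) (peval e x q) =
  if ptarget p == q.1 then peval e x (p.1, p.2 ++ q.2) else 0.
Proof.
move=> vp vq; case: eqP => [E|/eqP nE]; last first.
  rewrite -(peval_end vp) -(peval_start vq) fd_mulA -[X in fd_mul A X _]fd_mulA.
  by rewrite idemE (negPf nE) fd_mul0r fd_mul0l.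
case: p vp E => i u; elim: u i => [|a u IH] i vp E.
  have {}E : i = q.1 := E.
  by rewrite E -[peval e x (_, [::])]/(e q.1) peval_start // -surjective_pairing.
have vu : pvalid (Q := Q) (qt a, u) by move: vp; rewrite pvalid_cons => /and3P[].
rewrite peval_cons //= -fd_mulA IH //= -(@peval_cons i) //.
rewrite -cat_cons pvalid_cat vp; move: vq.
by rewrite E -surjective_pairing.
Qed.

Lemma ceval_cat (c c' : combo Q k) : ceval e x (c ++ c') = ceval e x c + ceval e x c'.
Proof. by rewrite /ceval big_cat. Qed.

Lemma ceval_scale l (c : combo Q k) : ceval e x (scale_combo l c) = l *: ceval e x c.
Proof. by rewrite /ceval big_map scaler_sumr; apply: eq_bigr => t _; rewrite scalerA. Qed.

Lemma ceval_eq (c c' : combo Q k) : (forall p, coef c p = coef c' p) -> ceval e x c = ceval e x c'.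
Proof. exact: combo_sum_eq. Qed.

Lemma ceval1 l p : ceval e x [:: (l, p)] = l *: peval e x p.
Proof. by rewrite /ceval big_seq1. Qed.

Lemma ceval_mul_pcp p (c : combo Q k) q : pvalid p -> cvalid c -> pvalid q ->
  ceval e x (mul_pcp p c q) = fd_mul A (fd_mul A (peval e x p) (ceval e x c)) (peval e x q).
Proof.
move=> vp vc vq; elim: c vc => [_|[l w] c IH /andP[vw vc]].
  by rewrite /mul_pcp /ceval /= !big_nil fd_mul0r fd_mul0l.
rewrite mul_pcp_cons ceval_cat IH // [ceval e x ((l, w) :: c)]/ceval big_cons.
rewrite fd_mulDr fd_mulDl -/(ceval e x c); congr (_ + _).
rewrite /= in vw; rewrite fd_mulZr fd_mulZl peval_mul //=.
case: eqP => [E|_] /=; last by rewrite fd_mul0l scaler0 /ceval big_nil.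
have Ew : ptarget (Q := Q) (p.1, p.2 ++ w.2) = ptarget w.
  by rewrite ptarget_cat -surjective_pairing E -surjective_pairing.
rewrite peval_mul // ?Ew.
  by case: eqP => _; rewrite ?scaler0 ?ceval1 ?catA // /ceval big_nil.
by rewrite pvalid_cat -!surjective_pairing vp E -surjective_pairing.
Qed.

Lemma ceval_in_ideal rels (c : combo Q k) :
  (forall r, r \in rels -> cvalid r /\ ceval e x r = 0) ->
  in_ideal rels c -> ceval e x c = 0.
Proof.
move=> H [ts [hts /ceval_eq ->]]; elim: ts hts => [|t ts IH] /=.
  by rewrite /ceval big_nil.
case/andP=> /and3P[v1 v2 lt] /IH E; rewrite ceval_cat E addr0 ceval_scale.
have [vr r0] := H _ (mem_nth [::] lt).
by rewrite ceval_mul_pcp // r0 fd_mul0r fd_mul0l scaler0.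
Qed.

End Evaluation.

(** * The dual bimodule, the trivial extension and its form *)

Lemma dpairDl (f g : 'rV[k]_d) a : dpair (f + g) a = dpair f a + dpair g a.
Proof. by rewrite /dpair -big_split; apply: eq_bigr => i _; rewrite mxE mulrDl. Qed.
Lemma dpairDr (f : 'rV[k]_d) a b : dpair f (a + b) = dpair f a + dpair f b.
Proof. by rewrite /dpair -big_split; apply: eq_bigr => i _; rewrite mxE mulrDr. Qed.
Lemma dpairZl l (f : 'rV[k]_d) a : dpair (l *: f) a = l * dpair f a.
Proof. by rewrite /dpair mulr_sumr; apply: eq_bigr => i _; rewrite mxE mulrA. Qed.
Lemma dpairZr l (f : 'rV[k]_d) a : dpair f (l *: a) = l * dpair f a.
Proof. by rewrite /dpair mulr_sumr; apply: eq_bigr => i _; rewrite mxE mulrCA. Qed.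
Lemma dpair0l (a : 'rV[k]_d) : dpair 0 a = 0.
Proof. by rewrite /dpair big1 // => i _; rewrite mxE mul0r. Qed.
Lemma dpair0r (f : 'rV[k]_d) : dpair f 0 = 0.
Proof. by rewrite /dpair big1 // => i _; rewrite mxE mulr0. Qed.
Lemma dpairC (f a : 'rV[k]_d) : dpair f a = dpair a f.
Proof. by apply: eq_bigr => i _; rewrite mulrC. Qed.
Lemma dpair_sumr (I : Type) (r : seq I) (P : pred I) (F : I -> 'rV[k]_d) (f : 'rV[k]_d) :
  dpair f (\sum_(i <- r | P i) F i) = \sum_(i <- r | P i) dpair f (F i).
Proof. exact: (big_morph (dpair f) (dpairDr f) (dpair0r f)). Qed.
Lemma dpair_suml (I : Type) (r : seq I) (P : pred I) (F : I -> 'rV[k]_d) (a : 'rV[k]_d) :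
  dpair (\sum_(i <- r | P i) F i) a = \sum_(i <- r | P i) dpair (F i) a.
Proof. by rewrite dpairC dpair_sumr; apply: eq_bigr => i _; rewrite dpairC. Qed.
Lemma dpair_delta (f : 'rV[k]_d) i : dpair f (delta_mx ord0 i) = f ord0 i.
Proof.
rewrite /dpair (bigD1 i) //= mxE !eqxx mulr1 big1 ?addr0 // => j nj.
by rewrite mxE (negPf nj) andbF mulr0.
Qed.
Lemma dpair_inj (f g : 'rV[k]_d) : (forall a, dpair f a = dpair g a) -> f = g.
Proof. by move=> E; apply/rowP => i; rewrite -!dpair_delta E. Qed.

Lemma dpair_act_l (a g y : 'rV[k]_d) : dpair (act_l (A := A) a g) y = dpair g (fd_mul A y a).
Proof.
rewrite [y in RHS]row_sum_delta fd_mul_suml dpair_sumr; apply: eq_bigr => i _.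
by rewrite fd_mulZl dpairZr mxE mulrC.
Qed.
Lemma dpair_act_r (f b y : 'rV[k]_d) : dpair (act_r (A := A) f b) y = dpair f (fd_mul A b y).
Proof.
rewrite [y in RHS]row_sum_delta fd_mul_sumr dpair_sumr; apply: eq_bigr => i _.
by rewrite fd_mulZr dpairZr mxE mulrC.
Qed.

Lemma act_l0 (a : 'rV[k]_d) : act_l (A := A) a 0 = 0.
Proof. by apply: dpair_inj => y; rewrite dpair_act_l !dpair0l. Qed.
Lemma act_0l (g : 'rV[k]_d) : act_l (A := A) 0 g = 0.
Proof. by apply: dpair_inj => y; rewrite dpair_act_l fd_mul0r dpair0r dpair0l. Qed.
Lemma act_r0 (f : 'rV[k]_d) : act_r (A := A) f 0 = 0.
Proof. by apply: dpair_inj => y; rewrite dpair_act_r fd_mul0l dpair0r dpair0l. Qed.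
Lemma act_0r (b : 'rV[k]_d) : act_r (A := A) 0 b = 0.
Proof. by apply: dpair_inj => y; rewrite dpair_act_r !dpair0l. Qed.

Lemma triv_mulE (a f b g : 'rV[k]_d) :
  fd_mul (TExt A) (row_mx a f) (row_mx b g) =
  row_mx (fd_mul A a b) (act_l (A := A) a g + act_r (A := A) f b).
Proof. by rewrite /= /triv_mul !row_mxKl !row_mxKr. Qed.

Lemma row_mx_suml (I : Type) (r : seq I) (l : I -> k) (F : I -> 'rV[k]_d) :
  row_mx (\sum_(i <- r) l i *: F i) 0 = \sum_(i <- r) l i *: row_mx (F i) (0 : 'rV[k]_d).
Proof.
elim: r => [|i r IH]; first by rewrite !big_nil row_mx0.
by rewrite !big_cons -IH scale_row_mx scaler0 add_row_mx addr0.
Qed.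

Lemma row_mx_sumr (I : Type) (r : seq I) (l : I -> k) (F : I -> 'rV[k]_d) :
  row_mx 0 (\sum_(i <- r) l i *: F i) = \sum_(i <- r) l i *: row_mx (0 : 'rV[k]_d) (F i).
Proof.
elim: r => [|i r IH]; first by rewrite !big_nil row_mx0.
by rewrite !big_cons -IH scale_row_mx scaler0 add_row_mx addr0.
Qed.

Lemma TExt_split (w : 'rV[k]_(fd_dim (TExt A))) :
  exists a f : 'rV[k]_d, w = row_mx a f.
Proof. by exists (lsubmx (w : 'rV_(d + d))), (rsubmx (w : 'rV_(d + d))); rewrite hsubmxK. Qed.

Lemma TExt_is_fdalg : is_fdalg (TExt A).
Proof.
split; [|split; [|split]].
- move=> l x y z; have [[[a [f ->]] [b [g ->]]] [c [h ->]]] :=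
    (TExt_split x, TExt_split y, TExt_split z).
  rewrite scale_row_mx add_row_mx !triv_mulE scale_row_mx add_row_mx fd_mulDl fd_mulZl.
  congr row_mx; apply: dpair_inj => y'.
  rewrite !(dpairDl, dpairZl, dpair_act_l, dpair_act_r, fd_mulDr, fd_mulZr, dpairDr, dpairZr).
  by rewrite mulrDr addrACA.
- move=> l x y z; have [[[a [f ->]] [b [g ->]]] [c [h ->]]] :=
    (TExt_split x, TExt_split y, TExt_split z).
  rewrite scale_row_mx add_row_mx !triv_mulE scale_row_mx add_row_mx fd_mulDr fd_mulZr.
  congr row_mx; apply: dpair_inj => y'.
  rewrite !(dpairDl, dpairZl, dpair_act_l, dpair_act_r, fd_mulDl, fd_mulZl, dpairDr, dpairZr).
  by rewrite mulrDr addrACA.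
- move=> x y z; have [[[a [f ->]] [b [g ->]]] [c [h ->]]] :=
    (TExt_split x, TExt_split y, TExt_split z).
  rewrite !triv_mulE fd_mulA; congr row_mx; apply: dpair_inj => y'.
  by rewrite !(dpairDl, dpair_act_l, dpair_act_r, fd_mulA) addrA.
- move=> x; have [a [f ->]] := TExt_split x.
  rewrite [fd_one _]/= !triv_mulE fd_mul1l fd_mul1r.
  split; congr row_mx; apply: dpair_inj => y'.
    by rewrite dpairDl dpair_act_l dpair_act_r fd_mul1r dpair0l addr0.
  by rewrite dpairDl dpair_act_l dpair_act_r fd_mul1l dpair0l add0r.
Qed.

Definition triv_form (w : 'rV[k]_(d + d)) : k := dpair (rsubmx w) (fd_one A).

Lemma triv_formD w w' : triv_form (w + w') = triv_form w + triv_form w'.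
Proof. by rewrite /triv_form linearD dpairDl. Qed.
Lemma triv_formZ l w : triv_form (l *: w) = l * triv_form w.
Proof. by rewrite /triv_form linearZ dpairZl. Qed.
Lemma triv_form0 : triv_form 0 = 0.
Proof. by rewrite /triv_form linear0 dpair0l. Qed.
Lemma triv_form_sum (I : Type) (r : seq I) (P : pred I) (F : I -> 'rV[k]_(d + d)) :
  triv_form (\sum_(i <- r | P i) F i) = \sum_(i <- r | P i) triv_form (F i).
Proof. exact: (big_morph triv_form triv_formD triv_form0). Qed.

Lemma triv_form_mul (a f b g : 'rV[k]_d) :
  triv_form (fd_mul (TExt A) (row_mx a f) (row_mx b g)) = dpair g a + dpair f b.
Proof.
by rewrite triv_mulE /triv_form row_mxKr dpairDl dpair_act_l dpair_act_r fd_mul1l fd_mul1r.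
Qed.

(** Testing against [(0, g)] isolates the component in [A], testing against [(b, 0)] the component
    in [D(A)]. *)
Lemma triv_form_nondeg (w : 'rV[k]_(d + d)) :
  (forall w', triv_form (fd_mul (TExt A) w w') = 0) -> w = 0.
Proof.
move=> H; rewrite -[w]hsubmxK -[RHS]hsubmxK !linear0; congr row_mx.
  apply: dpair_inj => g; have := H (row_mx 0 g).
  by rewrite -[w]hsubmxK triv_form_mul dpair0r addr0 row_mxKl dpair0l dpairC.
apply: dpair_inj => b; have := H (row_mx b 0).
by rewrite -[w]hsubmxK triv_form_mul dpair0l add0r row_mxKr dpair0l.
Qed.

End FdAlg.

(** * Germs of the graph *)

Section Orbits.
Variables (T : finType) (f : T -> T).
Hypothesis injf : injective f.

Lemma order_iter_inj n x : order f (iter n f x) = order f x.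
Proof.
apply: eq_card => y; rewrite !inE; apply: (same_connect (fconnect_sym injf)).
by rewrite fconnect_sym // fconnect_iter.
Qed.

Lemma rot1_orbit x : rot 1 (orbit f x) = orbit f (f x).
Proof.
rewrite /orbit (order_iter_inj 1 x) -(orderSpred f x) /= rot1_cons.
rewrite -[RHS]/(traject f (f x) (order f x).-1.+1) trajectSr.
by rewrite -iterSr orderSpred iter_order.
Qed.

Lemma rot_orbit n x : (n <= order f x)%N -> rot n (orbit f x) = orbit f (iter n f x).
Proof.
elim: n => [|n IH] ltn; first by rewrite rot0.
by rewrite rotS ?size_orbit // IH 1?ltnW // rot1_orbit.
Qed.

Lemma traject_order_ge n x : (order f x <= n)%N ->
  traject f x n = orbit f x ++ traject f x (n - order f x).
Proof. by move=> le; rewrite -{1}(subnKC le) trajectD iter_order. Qed.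

End Orbits.

(** A proper rotation brings a different entry to the head. Orbits have no repetitions, so the
    multiplicities in [G_equals] come out as 1. *)
Lemma rperiod_uniq (U : eqType) (y : U) (ys : seq U) :
  uniq (y :: ys) -> rperiod (y :: ys) = size (y :: ys).
Proof.
move=> uy; rewrite /rperiod; set P := fun r => _.
have H n : (n < size ys)%N -> ~~ P n.
  move=> lt; apply/eqP => /(congr1 (fun z => nth y z 0)).
  rewrite /rot nth_cat size_drop /= subSS subn_gt0 lt nth_drop addn0 /=.
  by move=> E; case/andP: uy; rewrite -E mem_nth.
apply: (congr1 S); rewrite -[size (y :: ys)]/(size ys).+1 -(addn1 (size ys)) iotaD.
rewrite find_cat size_iota /= add0n.
have -> : has P (iota 0 (size ys)) = false.
  by apply/hasPn => n; rewrite mem_iota add0n => /andP[_ /H].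
by rewrite /P -[(size ys).+1]/(size (y :: ys)) rot_size eqxx addn0.
Qed.

Section Germs.
Variables (V Arr : finType) (s t : Arr -> V) (rel : Arr -> Arr -> bool).
Hypothesis has_arrow : exists a : Arr, True.
Hypothesis connQ : qconnected (gquiver s t).
Hypothesis gentleQ : gentle s t rel.
Hypothesis admQ : admissible s t rel.

Local Notation germ := (germ s t rel).
Local Notation sigma := (sigmaG (s := s) (t := t) (rel := rel)).
Local Notation step := (fstep (s := s) (t := t) (rel := rel)).
Local Notation Gam := (GammaA s t rel).
Implicit Types (g h : germ) (a b c : Arr) (i : V).

Lemma germ_eq g h : gv g = gv h -> gin g = gin h -> gout g = gout h -> g = h.
Proof.
case: g h => [[[i x] y] p] [[[j x'] y'] p'] E1 E2 E3; apply: val_inj.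
by move: E1 E2 E3; rewrite /gv /gin /gout /= => -> -> ->.
Qed.

Lemma germP g : germ_ok s t rel (gv g, gin g, gout g).
Proof. by case: g => [[[i x] y] p]. Qed.

Lemma gout_vertex g b : gout g = Some b -> gv g = s b.
Proof.
move=> E; have := germP g; rewrite E /=.
by case: (gin g) => [a /and3P[_ /eqP]|/andP[/eqP]].
Qed.

Lemma gin_vertex g a : gin g = Some a -> gv g = t a.
Proof.
move=> E; have := germP g; rewrite E /=.
by case: (gout g) => [b /and3P[/eqP]|/andP[/eqP]].
Qed.

(** By (S2) at most one arrow precedes [b] without a relation, and [germ_ok] permits [None] as
    incoming arrow only if there is no such arrow. *)
Lemma gout_inj g h b : gout g = Some b -> gout h = Some b -> g = h.
Proof.
move=> Eg Eh; have vE : gv g = gv h by rewrite (gout_vertex Eg) (gout_vertex Eh).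
apply: germ_eq => //; last by rewrite Eg Eh.
have := germP g; have := germP h; rewrite -vE Eg Eh /=.
case: (gin g) => [a|]; case: (gin h) => [a'|] //.
- move=> /and3P[/eqP ta' /eqP sb na'] /and3P[/eqP ta _ na].
  have [_ [_ [/(_ b)[_ H] _]]] := gentleQ.
  by congr Some; apply: (card_le1_eqP H); rewrite inE ?ta ?ta' ?sb ?eqxx.
- by move=> /andP[_ /forallP/(_ a) H] /and3P[ta _ nr]; rewrite ta (negPf nr) in H.
- by move=> /and3P[/eqP ta _ nr] /andP[_ /forallP/(_ a')]; rewrite ta eqxx (negPf nr).
Qed.

Lemma gin_inj g h a : gin g = Some a -> gin h = Some a -> g = h.
Proof.
move=> Eg Eh; have vE : gv g = gv h by rewrite (gin_vertex Eg) (gin_vertex Eh).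
apply: germ_eq => //; first by rewrite Eg Eh.
have := germP g; have := germP h; rewrite -vE Eg Eh /=.
case: (gout g) => [b|]; case: (gout h) => [b'|] //.
- move=> /and3P[/eqP ta /eqP sb' nb'] /and3P[_ /eqP sb nb].
  have [_ [_ [/(_ a)[H _] _]]] := gentleQ.
  by congr Some; apply: (card_le1_eqP H); rewrite inE ?ta ?sb ?sb' ?eqxx.
- by move=> /andP[_ /forallP/(_ b) H] /and3P[_ sb nr]; rewrite sb (negPf nr) in H.
- by move=> /and3P[_ /eqP sb nr] /andP[_ /forallP/(_ b')]; rewrite sb eqxx (negPf nr).
Qed.

Lemma outgerm_ok b : germ_ok s t rel (s b, [pick a | (t a == s b) && ~~ rel a b], Some b).
Proof.
rewrite /=; case: pickP => [a /andP[-> ->]|H]; rewrite eqxx //=.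
by apply/forallP => a; apply/implyP => ta; have := H a; rewrite ta => /negbFE.
Qed.
(** The half-edge that stands for the arrow [b] in the Brauer quiver. *)
Definition outgerm b : germ := exist (fun x => germ_ok s t rel x) _ (outgerm_ok b).

Lemma ingerm_ok a : germ_ok s t rel (t a, Some a, [pick b | (s b == t a) && ~~ rel a b]).
Proof.
rewrite /=; case: pickP => [b /andP[-> ->]|H]; rewrite eqxx //=.
by apply/forallP => b; apply/implyP => sb; have := H b; rewrite sb => /negbFE.
Qed.
Definition ingerm a : germ := exist (fun x => germ_ok s t rel x) _ (ingerm_ok a).

Lemma gout_outgerm b : gout (outgerm b) = Some b. Proof. by []. Qed.
Lemma gin_ingerm a : gin (ingerm a) = Some a. Proof. by []. Qed.
Lemma gv_ingerm a : gv (ingerm a) = t a. Proof. by []. Qed.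
Lemma gout_outgermK g b : gout g = Some b -> g = outgerm b.
Proof. by move=> E; apply: gout_inj E _. Qed.
Lemma gin_ingermK g a : gin g = Some a -> g = ingerm a.
Proof. by move=> E; apply: gin_inj E _. Qed.
Lemma outgerm_inj : injective outgerm.
Proof. by move=> a b /(congr1 (@gout _ _ _ _ _)) []. Qed.

Lemma ingerm_outgerm a b : t a = s b -> ~~ rel a b -> ingerm a = outgerm b.
Proof.
move=> E nr; have ok : germ_ok s t rel (t a, Some a, Some b) by rewrite /= E !eqxx.
rewrite -(@gin_ingermK (exist (fun x => germ_ok s t rel x) _ ok) a) //.
by rewrite -(@gout_outgermK (exist (fun x => germ_ok s t rel x) _ ok) b).
Qed.

Lemma ingerm_outgerm_rel a b : ingerm a = outgerm b -> (t a == s b) && ~~ rel a b.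
Proof.
move=> E; have := germP (ingerm a); rewrite gin_ingerm.
have -> : gout (ingerm a) = Some b by rewrite E.
by rewrite /= eqxx /= eq_sym.
Qed.

(** * Chains of germs along maximal paths and the cyclic successor *)

Lemma stepP g h : reflect (exists2 b, gout g = Some b & gin h = Some b) (step g h).
Proof.
rewrite /fstep; apply: (iffP idP) => [|[b -> ->]] //.
by case: (gout g) (gin h) => [b|] [b'|] // /eqP <-; exists b.
Qed.

Lemma step_path_arrows h a p : gin h = Some a -> path step h p ->
  path (fun x y => (t x == s y) && ~~ rel x y) a (pmap (@gin _ _ _ _ _) p)
  /\ size (pmap (@gin _ _ _ _ _) p) = size p.
Proof.
elim: p h a => [|g p IH] h a E //= /andP[/stepP[b Eb Eg] /(IH _ _ Eg)[P <-]].
rewrite Eg /= P andbT; split=> //; have := germP h; rewrite E Eb /=.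
by case/and3P=> /eqP-> /eqP-> ->; rewrite eqxx.
Qed.

(** A chain of steps spells a path without relations, whose length admissibility bounds. *)
Lemma step_path_bounded : exists N, forall h p, path step h p -> (size p < N)%N.
Proof.
have [N HN] := admQ; exists N.+1 => h [|g p] //= /andP[/stepP[b _ Eg]].
case/(step_path_arrows Eg) => P <-; rewrite ltnNge; apply/negP => le.
pose q : qpath (gquiver s t) := (s b, b :: pmap (@gin _ _ _ _ _) p).
have vq : pvalid q.
  by rewrite /pvalid /= eqxx all_predT /= andbT; apply: sub_path P => x y /andP[].
have nq : ~~ has_rel rel q.
  by rewrite /has_rel /= negbK; apply: sub_path P => x y /andP[].
by rewrite (HN q vq) // in nq; apply: ltnW.
Qed.

Lemma exists_start g : exists2 h, gin h = None & connect step h g.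
Proof.
have [N HN] := step_path_bounded.
(* Going backwards from [g] either reaches a start or yields chains of every length [n], which the
   bound forbids. *)
suff H n : (exists2 h, gin h = None & connect step h g) \/
    exists h p, [/\ path step h p, last h p = g & size p = n].
  by case: (H N) => // -[h [p [/HN + _ E]]]; rewrite E ltnn.
elim: n => [|n [?|[h [p [P L S]]]]]; [by right; exists g, [::] | by left | ].
case E : (gin h) => [a|]; [right | by left; exists h => //; apply/connectP; exists p].
exists (outgerm a), (h :: p); split; rewrite /= ?S ?P ?andbT //.
by apply/stepP; exists a.
Qed.

(** The default value in [sigmaG] never stands in for a missing successor: an outgoing arrow leads
    to a next germ, and from an end [exists_start] leads back to a start. *)
Lemma sigmaRel_sigma g : sigmaRel g (sigma g).
Proof.
rewrite /sigmaG; case: pickP => //= H.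
case E : (gout g) => [b|].
  have := H (ingerm b); rewrite /sigmaRel; have -> // : step g (ingerm b).
  by apply/stepP; exists b.
have [h hN hc] := exists_start g.
by have := H h; rewrite /sigmaRel E hN hc !eqxx orbT.
Qed.

(** This includes the closing step, where both sides are [None]. *)
Lemma gin_sigma g : gin (sigma g) = gout g.
Proof.
by case/orP: (sigmaRel_sigma g) => [/stepP[b -> ->]|/and3P[/eqP -> /eqP -> _]].
Qed.

Lemma sigma_outgerm b : sigma (outgerm b) = ingerm b.
Proof. by apply: gin_ingermK; rewrite gin_sigma. Qed.

Lemma step_sigma g h : step g h -> h = sigma g.
Proof. by case/stepP=> b E Eh; apply: (@gin_inj _ _ b) => //; rewrite gin_sigma. Qed.

Lemma sigma_step g b : gout g = Some b -> step g (sigma g).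
Proof. by move=> E; apply/stepP; exists b; rewrite ?gin_sigma. Qed.

Lemma connect_sigma_end g : gout g = None -> connect step (sigma g) g.
Proof.
by move=> E; case/orP: (sigmaRel_sigma g) => [/stepP[b]|/and3P[]//]; rewrite E.
Qed.

(** Steps are deterministic, so two chains from [x] agree until one of them stops. *)
Lemma connect_end_uniq x g h :
  connect step x g -> connect step x h -> gout g = None -> gout h = None -> g = h.
Proof.
case/connectP=> p P -> {g} /connectP[q P' ->] {h}.
elim: p x P q P' => [|y p IH] x /=.
  by move=> _ [|z q] //= /andP[/stepP[b ->]].
move=> /andP[S P] [|z q] /=; first by case/stepP: S => b ->.
by move=> /andP[S' P']; rewrite (step_sigma S') -(step_sigma S) in P' *; apply: IH.
Qed.

(** Germs with the same successor share their outgoing arrow; if there is none, both are ends of the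
    chain that begins at this successor. *)
Lemma sigma_inj : injective sigma.
Proof.
move=> g h E; have Eo : gout g = gout h by rewrite -!gin_sigma E.
case Eg : (gout g) => [b|]; first by apply: (gout_inj Eg); rewrite -Eo.
apply: (@connect_end_uniq (sigma g)); rewrite -?Eo //; first exact: connect_sigma_end.
by rewrite E; apply: connect_sigma_end; rewrite -Eo.
Qed.

Lemma btrunc_germ g : btrunc (G := Gam) g = (gin g == None) && (gout g == None).
Proof.
rewrite /btrunc /= andbT; apply/eqP/andP => [E|[/eqP Ei /eqP Eo]].
  rewrite -{1}E gin_sigma; case Eg : (gout g) => [b|] //.
  have S := sigma_step Eg; rewrite E in S.
  have [N HN] := step_path_bounded.
  (* A fixed germ with an outgoing arrow would step to itself forever. *)
  have P : path step g (nseq N g) by elim: (N) => //= n ->; rewrite S.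
  by have := HN _ _ P; rewrite size_nseq ltnn.
(* No step enters a germ without incoming arrow, so the chain from [sigma g] to [g] is empty. *)
have /connectP[p P L] := connect_sigma_end Eo.
case/lastP: p P L => [_ //|p y]; rewrite last_rcons rcons_path => /andP[_ /stepP[b _]] + E.
by rewrite -E Ei.
Qed.

Lemma btrunc_outgerm b : btrunc (G := Gam) (outgerm b) = false.
Proof. by rewrite btrunc_germ gout_outgerm andbF. Qed.

Lemma btrunc_ingerm b : btrunc (G := Gam) (ingerm b) = false.
Proof. by rewrite btrunc_germ gin_ingerm. Qed.

Lemma btrunc_sigma g : btrunc (G := Gam) (sigma g) = btrunc (G := Gam) g.
Proof. by rewrite /btrunc /= (inj_eq sigma_inj). Qed.

Lemma btrunc_iter n g : btrunc (G := Gam) (iter n sigma g) = btrunc (G := Gam) g.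
Proof. by elim: n => //= n; rewrite btrunc_sigma. Qed.

(** All iterates of an end [g] still lead to [g] by steps, so an end among them is [g] itself. Thus
    a cycle has at most one closing arrow. *)
Lemma orbit_end_uniq g h :
  fconnect sigma g h -> gout g = None -> gout h = None -> g = h.
Proof.
move=> /iter_findex <-; move: (findex _ _ _) => n Eg Eh.
suff C : connect step (iter n sigma g) g by apply: connect_end_uniq C _ _ _.
elim: n {Eh} => //= n IH; case E : (gout (iter n sigma g)) => [b|].
  case/connectP: IH => -[_ E'|y p /= /andP[/step_sigma <- P] L].
    by move: E; rewrite -[iter n sigma g]E' Eg.
  by apply/connectP; exists p.
have -> : iter n sigma g = g by apply: (connect_end_uniq (connect0 _ _) IH).
exact: connect_sigma_end.
Qed.

(** An orbit without an end would be an unbounded chain of steps. *)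
Lemma orbit_end g : exists2 h, fconnect sigma g h & gout h = None.
Proof.
case: (pickP [pred h | fconnect sigma g h && (gout h == None)]) => [h /andP[? /eqP ?]|H].
  by exists h.
have [N HN] := step_path_bounded.
suff P n x : fconnect sigma g x -> path step x (traject sigma (sigma x) n).
  by have := HN _ _ (P N g (connect0 _ _)); rewrite size_traject ltnn.
elim: n x => //= n IH x C; rewrite IH ?andbT; last first.
  exact: connect_trans C (fconnect1 _ _).
by have := H x; rewrite /= C /=; case E : (gout x) => [b|] // _; apply: sigma_step E.
Qed.

(** * The two germs at a vertex *)

Lemma nontrivial_germ i : exists2 g, gv g = i & ~~ btrunc (G := Gam) g.
Proof.
(* The first edge of a walk from [i] to [s a0] is an arrow at [i]; if the walk is empty, [a0] itself
   starts at [i]. *)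
have [a0 _] := has_arrow; have /connectP[[_ E|j p /=]] := connQ i (s a0).
  by exists (outgerm a0); rewrite ?btrunc_outgerm.
case/andP=> /existsP[a /orP[] /andP[/eqP E1 /eqP E2]] _ _.
  by exists (outgerm a); rewrite ?btrunc_outgerm.
by exists (ingerm a); rewrite ?btrunc_ingerm.
Qed.

Lemma trivial_germ_exists i : trivial_ok s t rel i ->
  exists2 g, gv g = i & btrunc (G := Gam) g.
Proof.
move=> ok; have ok' : germ_ok s t rel (i, None, None) by [].
by exists (exist (fun x => germ_ok s t rel x) _ ok') => //; rewrite btrunc_germ.
Qed.

(** An arrow at the vertex that [g] does not use gives a second germ. If there is none and [g] is
    nontrivial, the arrows of [g] are the only ones there, and [trivial_ok] holds. *)
Lemma other_germ g : exists2 h, gv h = gv g & h != g.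
Proof.
case Tg : (btrunc (G := Gam) g).
  have [h E nT] := nontrivial_germ (gv g); exists h => //.
  by apply: contraNneq nT => ->.
have triv : trivial_ok s t rel (gv g) -> exists2 h, gv h = gv g & h != g.
  case/trivial_germ_exists=> h E T; exists h => //.
  by apply: contraFneq Tg => <-.
case: (pickP [pred a | (t a == gv g) && (gin g != Some a)]) => [a /andP[/eqP E ne]|noin].
  by exists (ingerm a) => //; apply: contraNneq ne => <-.
case: (pickP [pred b | (s b == gv g) && (gout g != Some b)]) => [b /andP[/eqP E ne]|noout].
  by exists (outgerm b) => //; apply: contraNneq ne => <-.
apply: triv; rewrite /trivial_ok.
have -> : #|[set a | t a == gv g]| = (gin g != None).
  case Eg : (gin g) => [a|]; last first.
    by apply: eq_card0 => a; have := noin a; rewrite !inE /= Eg andbT.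
  rewrite -[RHS]/1%N -(cards1 a); apply: eq_card => c; have := noin c; rewrite !inE /= Eg.
  case: (c =P a) => [->|ne]; first by rewrite (gin_vertex Eg) eqxx.
  by case: eqP => //= _ /negbFE/eqP[/esym].
have -> : #|[set b | s b == gv g]| = (gout g != None).
  case Eg : (gout g) => [a|]; last first.
    by apply: eq_card0 => a; have := noout a; rewrite !inE /= Eg andbT.
  rewrite -[RHS]/1%N -(cards1 a); apply: eq_card => c; have := noout c; rewrite !inE /= Eg.
  case: (c =P a) => [->|ne]; first by rewrite (gout_vertex Eg) eqxx.
  by case: eqP => //= _ /negbFE/eqP[/esym].
have := germP g; move: Tg noin noout; rewrite btrunc_germ.
case: (gin g) => [a|]; case: (gout g) => [b|] //= _ noin noout /and3P[_ _ nr].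
apply/forallP => a'; apply/forallP => b'; apply/implyP => /andP[ta sb].
have := noin a'; rewrite /= ta /= => /negbFE/eqP[<-].
by have := noout b'; rewrite /= sb /= => /negbFE/eqP[<-].
Qed.

(** In each case of [trivial_ok] there is a single arrow that every nontrivial germ at the vertex
    must use; in the third case a germ with only an outgoing arrow would need a relation. *)
Lemma nontrivial_germ_uniq g h h' : btrunc (G := Gam) g -> gv h = gv g -> gv h' = gv g ->
  ~~ btrunc (G := Gam) h -> ~~ btrunc (G := Gam) h' -> h = h'.
Proof.
rewrite !btrunc_germ => /andP[/eqP gi /eqP go] vh vh' nh nh'.
have same_in a a' : gin h = Some a -> gin h' = Some a' ->
    #|[set x | t x == gv g]| == 1%N -> h = h'.
  move=> E E' /eqP/eq_leq/card_le1_eqP H; apply: (gin_inj E); rewrite E'; congr Some.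
  by apply: H; rewrite inE; [rewrite -vh (gin_vertex E) | rewrite -vh' (gin_vertex E')].
have same_out b b' : gout h = Some b -> gout h' = Some b' ->
    #|[set x | s x == gv g]| == 1%N -> h = h'.
  move=> E E' /eqP/eq_leq/card_le1_eqP H; apply: (gout_inj E); rewrite E'; congr Some.
  by apply: H; rewrite inE; [rewrite -vh (gout_vertex E) | rewrite -vh' (gout_vertex E')].
have := germP g; rewrite gi go /= => /or3P[/andP[/eqP/card0_eq H0 H1]|/andP[/eqP/card0_eq H0 H1]|].
- have nout (x : germ) b : gv x = gv g -> gout x <> Some b.
    by move=> vx E; have := H0 b; rewrite !inE -vx (gout_vertex E) eqxx.
  case E : (gin h) nh => [a|] /=; last by case E' : (gout h) (nout h) => [b|] // /(_ b vh).
  case E' : (gin h') nh' => [a'|] /=; last by case F : (gout h') (nout h') => [b|] // /(_ b vh').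
  by move=> _ _; exact: same_in E E' H1.
- have nin (x : germ) b : gv x = gv g -> gin x <> Some b.
    by move=> vx E; have := H0 b; rewrite !inE -vx (gin_vertex E) eqxx.
  case E : (gin h) nh => [a|] /=; first by case: (nin h a).
  case E' : (gin h') nh' => [a'|] /=; first by case: (nin h' a').
  by case F : (gout h) => [b|] //; case F' : (gout h') => [b'|] // _ _; exact: same_out F F' H1.
case/and3P=> H1 _ /forallP nr.
have [a0 /= ] : exists a, a \in [set x | t x == gv g] by apply/card_gt0P; rewrite (eqP H1).
rewrite inE => ta0.
have gin_some (x : germ) : gv x = gv g -> ~~ ((gin x == None) && (gout x == None)) ->
    exists a, gin x = Some a.
  move=> vx; have := germP x; case E : (gin x) => [a|]; first by exists a.
  case F : (gout x) => [b|] //= /andP[sb /forallP/(_ a0)]; rewrite vx ta0 /= => r.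
  by have /forallP/(_ b) := nr a0; rewrite ta0 -vx sb r.
have [a E] := gin_some h vh nh; have [a' E'] := gin_some h' vh' nh'.
exact: same_in E E' H1.
Qed.

End Germs.

(** * The presentation of the trivial extension *)

Section TrivialExtension.
Variables (k : fieldType) (V Arr : finType) (s t : Arr -> V) (rel : Arr -> Arr -> bool).
Variable A : fdalg k.
Hypothesis has_arrow : exists a : Arr, True.
Hypothesis connQ : qconnected (gquiver s t).
Hypothesis gentleQ : gentle s t rel.
Hypothesis admQ : admissible s t rel.
Hypothesis algA : is_fdalg A.
Local Notation d := (fd_dim A).
Local Notation hrel := (has_rel (s := s) (t := t) rel).
Local Notation GQ := (gquiver s t).
Local Notation Gam := (GammaA s t rel).
Local Notation BQ := (bquiver Gam).
Local Notation germ := (germ s t rel).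
Local Notation sigma := (sigmaG (s := s) (t := t) (rel := rel)).

Variables (e : qV GQ -> 'rV[k]_d) (x : qA GQ -> 'rV[k]_d).
Hypothesis idemA : forall u v, fd_mul A (e u) (e v) = if u == v then e u else 0.
Hypothesis sumA : \sum_v e v = fd_one A.
Hypothesis arrA : forall a : qA GQ, qarr a ->
  fd_mul A (e (qs a)) (x a) = x a /\ fd_mul A (x a) (e (qt a)) = x a.
Hypothesis kerA : forall c : combo GQ k, cvalid c ->
  (ceval e x c = 0 <-> in_ideal (gentle_rels s t rel k) c).
Variable cb : 'I_d -> combo GQ k.
Hypothesis cbP : forall i, cvalid (cb i) /\ ceval e x (cb i) = delta_mx ord0 i.

(** * The path basis of the gentle algebra and its dual basis *)

Lemma has_rel_cat i u a b v : rel a b -> hrel (i, u ++ a :: b :: v).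
Proof. by case: u => [|c u] r; rewrite /has_rel /= ?cat_path /= r ?andbF. Qed.

(** Generators are monomials, so only paths containing a relation occur in the ideal. This makes the
    relation-free paths independent in [A]. *)
Lemma coef_gentle_ideal (c : combo GQ k) p :
  in_ideal (gentle_rels s t rel k) c -> ~~ hrel p -> coef c p = 0.
Proof.
case=> ts [/allP hts ->] np; rewrite combo_coef_flatten big_seq big1 // => z zts.
have /and3P[_ _ lt] := hts z zts; rewrite combo_coef_scale.
have /mapP[[a b]] := mem_nth [::] lt; rewrite mem_enum inE /= => r ->.
rewrite mul_pcp_cons /= cats0; case: ifP => _; last by rewrite /coef big_nil mulr0.
rewrite combo_coef1; case: eqP => [E|_]; last by rewrite mulr0.
by rewrite -E has_rel_cat in np.
Qed.

Lemma peval_has_rel (p : qpath GQ) : pvalid p -> hrel p -> peval e x p = 0.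
Proof.
case: p => i [|a u] vp // hr.
have [u1 [b [c [u2 [E]]]]] := not_path_split (hr : ~~ path (fun a b => ~~ rel a b) a u).
rewrite negbK => r; rewrite E in vp *.
rewrite -[peval e x _]scale1r -ceval1; apply/(kerA _).
  by rewrite /cvalid /= vp.
apply: (@in_ideal_monomial GQ k _ i u1 (s b, [:: b; c]) u2) => //.
  by apply/mapP; exists (b, c); rewrite ?mem_enum.
by move: vp; rewrite pvalid_cat pvalid_cons => /andP[_ /and3P[/eqP <-]].
Qed.

(* The element of [D A] dual to the path [p] with respect to the basis of paths outside [I]. *)
Definition dual_path (p : qpath GQ) : 'rV[k]_d := \row_i coef (cb i) p.

Lemma dual_pathE (p q : qpath GQ) : ~~ hrel p -> pvalid q ->
  dpair (dual_path p) (peval e x q) = (q == p)%:R.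
Proof.
move=> np vq; pose y := peval e x q.
(* The difference of [q] and the chosen preimage of its value lies in the kernel, hence in the
   ideal, so its coefficient at [p] vanishes. *)
pose c := (1, q) :: flatten [seq scale_combo (- y ord0 i) (cb i) | i <- enum 'I_d].
have vc : cvalid c.
  rewrite /cvalid /= vq; apply/allP => z /flatten_mapP[i _ /mapP[z' z'i ->]] /=.
  by have [/allP/(_ _ z'i)] := cbP i.
have : ceval e x c = 0.
  rewrite /ceval big_cons scale1r big_flatten big_map enumT /= -/y.
  rewrite {1}[y]row_sum_delta -big_split big1 // => i _ /=.
  rewrite -[\sum_(_ <- _) _]/(ceval e x (scale_combo _ _)) ceval_scale.
  by have [_ ->] := cbP i; rewrite scaleNr subrr.
move/(kerA vc)/coef_gentle_ideal/(_ np); rewrite /c -cat1s combo_coef_cat combo_coef1.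
rewrite combo_coef_flatten enumT => /eqP; rewrite addr_eq0 => /eqP E.
have -> : (q == p)%:R = (if q == p then 1 else 0) :> k by case: ifP.
rewrite E -sumrN; apply: eq_bigr => i _.
by rewrite combo_coef_scale mulNr opprK mxE mulrC.
Qed.

(** [qpath] is an infinite type; the paths in the chosen preimages of the coordinate vectors are
    finitely many, and those among them without a relation span [A]. *)
Definition basis_paths : seq (qpath GQ) :=
  [seq p <- undup (flatten [seq [seq z.2 | z <- cb i] | i <- enum 'I_d]) | ~~ hrel p].

Lemma basis_pathsP p : p \in basis_paths -> pvalid p /\ ~~ hrel p.
Proof.
rewrite mem_filter mem_undup => /andP[-> /flatten_mapP[i _ /mapP[z zi ->]]].
by have [/allP/(_ _ zi)] := cbP i.
Qed.

Lemma dual_expand (g : 'rV[k]_d) :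
  g = \sum_(p <- basis_paths) dpair g (peval e x p) *: dual_path p.
Proof.
apply: dpair_inj => a; rewrite [a]row_sum_delta !dpair_sumr; apply: eq_bigr => i _.
rewrite !dpairZr; congr (_ * _); have [vi Ei] := cbP i.
rewrite -{1}Ei /ceval dpair_sumr; under eq_bigr => z do rewrite dpairZr.
rewrite -[LHS]/(\sum_(z <- cb i) z.1 *: (dpair g (peval e x z.2) : k^o)).
pose S := undup (flatten [seq [seq z.2 | z <- cb i] | i <- enum 'I_d]).
have subS j : {subset [seq z.2 | z <- cb j] <= S}.
  by move=> p pj; rewrite mem_undup; apply/flatten_mapP; exists j; rewrite ?mem_enum.
rewrite (@combo_sum_coef _ _ _ (fun p => dpair g (peval e x p) : k^o) _ S) ?undup_uniq //.
rewrite dpair_suml big_filter [RHS]big_mkcond [LHS]big_seq [RHS]big_seq.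
apply: eq_bigr => p; rewrite mem_undup => /flatten_mapP[j _ /mapP[z zj Ep]].
case: ifP => [_|/negbFE hr]; first by rewrite dpairZl dpair_delta mxE mulrC.
rewrite peval_has_rel ?dpair0r ?scaler0 // Ep.
by have [/allP/(_ _ zj)] := cbP j.
Qed.

Lemma dual_eq (f g : 'rV[k]_d) :
  (forall q : qpath GQ, pvalid q -> dpair f (peval e x q) = dpair g (peval e x q)) -> f = g.
Proof.
move=> H; apply/rowP => i; rewrite -!dpair_delta; have [vi <-] := cbP i.
rewrite /ceval !dpair_sumr big_seq [RHS]big_seq; apply: eq_bigr => z zi.
by rewrite !dpairZr H //; apply: (allP vi).
Qed.

(** * Paths of the gentle quiver inside the Brauer quiver *)

Local Notation cyc := (orbit sigma).
Let sinj := sigma_inj gentleQ admQ.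

Definition lift (q : qpath GQ) : qpath BQ := (q.1, [seq outgerm s t rel b | b <- q.2]).

Lemma qt_outgerm b : qt (q := BQ) (outgerm s t rel b) = t b.
Proof. by rewrite /= sigma_outgerm. Qed.

Lemma pvalid_lift q : pvalid (lift q) = pvalid q.
Proof.
case: q => i u; rewrite /lift /=; elim: u i => [|b u IH] i //=.
by rewrite !pvalid_cons qt_outgerm IH [qarr _](negbT (btrunc_outgerm _ _)).
Qed.

Lemma ptarget_lift q : ptarget (lift q) = ptarget q.
Proof.
case: q => i u; rewrite /ptarget /= -map_comp; congr last.
by apply: eq_map => b; apply: qt_outgerm.
Qed.

Lemma lift_inj p q : lift p = lift q -> p = q.
Proof.
by case: p q => [i u] [j v] [-> /(inj_map (@outgerm_inj _ _ s t rel)) ->].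
Qed.

Lemma liftP i (ys : seq germ) : ~~ has (fun h => gout h == None) ys ->
  (i, ys) = lift (i, pmap (@gout _ _ s t rel) ys).
Proof.
rewrite /lift /= => H; congr pair; elim: ys H => //= h ys IH.
case E : (gout h) => [b|] //= /IH <-.
by rewrite -(gout_outgermK gentleQ E).
Qed.

Lemma traject_arrows g (bs : seq Arr) :
  [seq outgerm s t rel b | b <- bs] = traject sigma g (size bs) ->
  let q : qpath GQ := (gv g, bs) in
  [/\ pvalid q, ~~ hrel q & ptarget q = gv (iter (size bs) sigma g)].
Proof.
elim: bs g => //= b bs IH g [Eb E]; rewrite -iterS iterSr.
have [vq nq tq] := IH _ E; move: vq nq tq; rewrite -Eb sigma_outgerm // gv_ingerm.
move=> vq nq tq; split=> //; first by rewrite pvalid_cons /= eqxx.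
case: bs {IH vq tq} E nq => //= c bs [E _]; rewrite /has_rel /= !negbK => ->.
by rewrite -Eb sigma_outgerm // in E; case/andP: (ingerm_outgerm_rel (esym E)) => _ ->.
Qed.

(** Converse of [traject_arrows]: composable arrows without a relation share the germ between them,
    so their half-edges are successive. *)
Lemma lift_traject i b (bs : seq Arr) : pvalid (Q := GQ) (i, b :: bs) ->
  ~~ hrel (i, b :: bs) ->
  [seq outgerm s t rel c | c <- b :: bs] = traject sigma (outgerm s t rel b) (size bs).+1.
Proof.
elim: bs b i => //= c bs IH b i; rewrite pvalid_cons => /and3P[_ _ v].
rewrite /has_rel negbK /= => /andP[nr p]; congr cons.
rewrite sigma_outgerm // (@ingerm_outgerm _ _ _ _ _ gentleQ b c) //.
  by apply: (IH c (t b)) => //; rewrite /has_rel negbK.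
by move: v; rewrite pvalid_cons => /and3P[/eqP].
Qed.

(* The maximal path ending at a germ with no outgoing arrow. *)
Definition mpath h : qpath GQ := (gv (sigma h), pmap (@gout _ _ s t rel) (behead (cyc h))).

Lemma cyc_cons h : cyc h = h :: traject sigma (sigma h) (order sigma h).-1.
Proof. by rewrite /orbit -orderSpred. Qed.

Lemma cyc_end_uniq h : gout h = None -> ~~ has (fun g => gout g == None) (behead (cyc h)).
Proof.
move=> E; apply/hasPn => y yh; apply/eqP => Ey.
have hy : h = y.
  apply: orbit_end_uniq E Ey => //; rewrite fconnect_orbit; exact: mem_behead yh.
by have := orbit_uniq sigma h; rewrite cyc_cons /=; rewrite cyc_cons /= -hy in yh; rewrite yh.
Qed.

Lemma cyc_mpath h : gout h = None ->
  cyc h = h :: [seq outgerm s t rel b | b <- (mpath h).2].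
Proof.
move=> E; have -> : cyc h = h :: behead (cyc h) by rewrite cyc_cons.
by congr cons; have [] := liftP (gv (sigma h)) (cyc_end_uniq E).
Qed.

Lemma mpathP h : gout h = None ->
  [/\ pvalid (mpath h), ~~ hrel (mpath h) & ptarget (mpath h) = gv h].
Proof.
move=> E; have := cyc_mpath E; rewrite cyc_cons => -[/esym L].
have Es : size (mpath h).2 = (order sigma h).-1.
  by rewrite -(size_map (outgerm s t rel)) L size_traject.
rewrite -Es in L; have := traject_arrows L.
by rewrite -iterSr Es orderSpred iter_order.
Qed.

(** * The map to the trivial extension and the form on images of paths *)

Definition eB (i : qV BQ) : 'rV[k]_(d + d) := row_mx (e i) 0.
Definition xB (h : qA BQ) : 'rV[k]_(d + d) :=
  if gout (h : germ) is Some b then row_mx (x b) 0 else row_mx 0 (dual_path (mpath h)).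

Local Notation T := (TExt A).
Let algT := TExt_is_fdalg algA.

Lemma idemB u v : fd_mul T (eB u) (eB v) = if u == v then eB u else 0.
Proof.
rewrite triv_mulE idemA act_l0 // act_0r // addr0.
by case: ifP => _ //; rewrite row_mx0.
Qed.

Lemma sumB : \sum_v eB v = fd_one T.
Proof.
rewrite /= -sumA; apply/esym.
apply: (big_morph (fun a => row_mx a 0)); last by rewrite row_mx0.
by move=> a b; rewrite add_row_mx addr0.
Qed.

(** For a closing arrow: the left action of [a] turns [m^*] into [y] maps to [m^*(y a)]. So [m^*] is
    fixed on the left by the idempotent at the end of [m] and on the right by the one at its
    start. *)
Lemma arrB h : qarr (q := BQ) h ->
  fd_mul T (eB (qs h)) (xB h) = xB h /\ fd_mul T (xB h) (eB (qt h)) = xB h.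
Proof.
move=> _; rewrite /eB /xB; case E : (gout (h : germ)) => [b|]; last first.
  have [vm nm tm] := mpathP E.
  rewrite !triv_mulE // fd_mul0l // fd_mul0r // act_0l // act_r0 // addr0 add0r.
  split; congr row_mx; apply: dual_eq => q vq.
    rewrite dpair_act_l // !dual_pathE //.
    rewrite -[e _]/(peval e x ((qs h, [::]) : qpath GQ)) peval_mul //= cats0.
    case: eqP => Eq; first by rewrite dual_pathE -?surjective_pairing.
    by rewrite dpair0r; case: eqP => // Em; case: Eq; rewrite Em tm.
  rewrite dpair_act_r // !dual_pathE //.
  rewrite -[e _]/(peval e x ((qt h, [::]) : qpath GQ)) peval_mul //= /ptarget /=.
  case: eqP => [Eq|Eq]; first by rewrite Eq -surjective_pairing dual_pathE.
  by rewrite dpair0r; case: eqP => // Em; case: Eq; rewrite Em.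
have [E1 E2] := @arrA b isT; rewrite (gout_outgermK gentleQ E) qt_outgerm.
by rewrite !triv_mulE // E1 E2 act_l0 // act_0r // act_l0 // act_0r // addr0.
Qed.

Local Notation peB := (peval (A := T) (Q := BQ) eB xB).
Local Notation form := (triv_form (A := A)).

Lemma peB_lift q : pvalid q -> peB (lift q) = row_mx (peval e x q) 0.
Proof.
case: q => i u; elim: u i => [|b u IH] i // v.
rewrite (peval_cons algA arrA) // (_ : lift _ = (i, outgerm s t rel b :: (lift (t b, u)).2)) //.
rewrite (peval_cons algT arrB); last first.
  by rewrite -[(i, _ :: _)]/(lift (i, b :: u)) pvalid_lift.
rewrite qt_outgerm -[(t b, (lift _).2)]/(lift (t b, u)) IH; last first.
  by move: v; rewrite pvalid_cons => /and3P[].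
by rewrite triv_mulE act_l0 // act_0r // addr0.
Qed.

Definition is_cyc (ys : seq germ) : bool :=
  [exists h, ~~ btrunc (G := Gam) h && (ys == cyc h)].

Lemma is_cycP ys : reflect (exists2 h, ~~ btrunc (G := Gam) h & ys = cyc h) (is_cyc ys).
Proof.
apply: (iffP existsP) => [[h /andP[nh /eqP]]|[h nh ->]]; first by exists h.
by exists h; rewrite nh eqxx.
Qed.

(** A full cycle is determined by its first arrow; all later uniqueness arguments rest on this. *)
Lemma is_cyc_cons h ys : is_cyc (h :: ys) -> ~~ btrunc (G := Gam) h /\ h :: ys = cyc h.
Proof.
case/is_cycP=> g ng E; have hg : h = g by move: E; rewrite cyc_cons; case.
by rewrite {1}hg E hg.
Qed.

Lemma is_cyc_rot u v : is_cyc (u ++ v) -> is_cyc (v ++ u).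
Proof.
case/is_cycP=> h nh E; apply/is_cycP; exists (iter (size u) sigma h).
  by rewrite btrunc_iter.
by rewrite -rot_orbit -?E ?rot_size_cat // -(size_orbit sigma) -E size_cat leq_addr.
Qed.

Lemma is_cyc_end ys : is_cyc ys -> has (fun g => gout g == None) ys.
Proof.
case/is_cycP=> h _ ->; have [g C E] := orbit_end admQ h.
by apply/hasP; exists g; rewrite -?fconnect_orbit // E.
Qed.

Lemma is_cyc_end_uniq u h v : gout h = None -> is_cyc (u ++ h :: v) ->
  ~~ has (fun g => gout g == None) v.
Proof.
move=> E /is_cyc_rot; rewrite cat_cons => /is_cyc_cons[_ Ec].
by have := cyc_end_uniq E; rewrite -Ec /= has_cat => /norP[].
Qed.

Lemma cyc_closed h : ptarget (Q := BQ) (gv h, cyc h) = gv h.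
Proof.
rewrite /ptarget /= cyc_cons /= (last_map (fun g : germ => gv (sigma g))) last_traject.
by rewrite -iterS orderSpred iter_order.
Qed.

Lemma is_cyc_closed i ys : is_cyc ys -> pvalid (Q := BQ) (i, ys) ->
  ptarget (Q := BQ) (i, ys) = i.
Proof.
case/is_cycP=> h _ ->; rewrite {1}cyc_cons pvalid_cons => /andP[/eqP <- _].
exact: cyc_closed.
Qed.

Lemma pvalidB_mid i (u : seq germ) h v : pvalid (Q := BQ) (i, u ++ h :: v) ->
  [/\ pvalid (Q := BQ) (i, u), ptarget (Q := BQ) (i, u) = gv h,
      ~~ btrunc (G := Gam) h & pvalid (Q := BQ) (gv (sigma h), v)].
Proof. by rewrite (@pvalid_cat BQ) pvalid_cons => /andP[vu /and3P[/eqP]]. Qed.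

Lemma peB_mid i (u : seq germ) h v : pvalid (Q := BQ) (i, u ++ h :: v) ->
  peB (i, u ++ h :: v) = fd_mul T (peB (i, u)) (fd_mul T (xB h) (peB (gv (sigma h), v))).
Proof.
move=> vw; rewrite (@pvalid_cat BQ) in vw.
have /andP[vu vhv] := vw.
by rewrite -(peval_cons algT arrB vhv) (peval_mul algT idemB arrB vu vhv) eqxx.
Qed.

Lemma lsub_peB i (u : seq germ) h v : pvalid (Q := BQ) (i, u ++ h :: v) -> gout h = None ->
  exists g : 'rV[k]_d, peB (i, u ++ h :: v) = row_mx 0 g.
Proof.
move=> vw Eh; rewrite peB_mid // /xB Eh.
have [[a [f ->]] [b [g ->]]] := (TExt_split (peB (i, u)), TExt_split (peB (gv (sigma h), v))).
rewrite [fd_mul T (row_mx 0 _) _]triv_mulE fd_mul0l // triv_mulE fd_mul0r //.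
by eexists.
Qed.

(* A product containing two dual elements vanishes, and one containing a single dual
   element [m^*] evaluates, after rotation, to the pairing of [m^*] with a path of [A]. *)
Lemma form_peB w : pvalid w -> form (peB w) = (is_cyc w.2)%:R.
Proof.
case: w => i ys vw /=; case: (boolP (has (fun g : germ => gout g == None) ys)); last first.
  move=> H; rewrite (liftP i H) peB_lift -?pvalid_lift -?liftP //.
  by rewrite /triv_form row_mxKr dpair0l; case C : (is_cyc ys) => //; rewrite is_cyc_end in H.
move=> Hs; case: (split_find Hs) vw => h u v /eqP Eh nu; rewrite cat_rcons => vw.
have [vu Ej nh vv] := pvalidB_mid vw; rewrite peB_mid //.
have -> : xB h = row_mx 0 (dual_path (mpath h)) by rewrite /xB Eh.
(* [h] is the first closing arrow. A second one in [v] makes the product lie in the square of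
   [D(A)], and no cycle has two. *)
case: (boolP (has (fun g : germ => gout g == None) v)) => [Hv|nv].
  have -> : is_cyc (u ++ h :: v) = false.
    by apply: contraTF Hv; apply: is_cyc_end_uniq.
  case: (split_find Hv) vv => h' v1 v2 /eqP Eh' _; rewrite cat_rcons => vv.
  have [g ->] := lsub_peB vv Eh'.
  rewrite [fd_mul T (row_mx 0 _) _]triv_mulE fd_mul0l // act_0l // act_r0 // addr0 row_mx0.
  by rewrite (fd_mul0r algT) triv_form0.
have [q1 E1] : exists q, lift q = (gv (sigma h), v) by eexists; rewrite (liftP _ nv).
have [q2 E2] : exists q, lift q = (i, u) by eexists; rewrite (liftP _ nu).
have v1 : pvalid q1 by rewrite -pvalid_lift E1.
have v2 : pvalid q2 by rewrite -pvalid_lift E2.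
have [vm nm tm] := mpathP Eh.
rewrite -E1 -E2 !peB_lift // [fd_mul T (row_mx 0 _) _]triv_mulE fd_mul0l // act_l0 // add0r.
rewrite triv_form_mul //.
rewrite dpair0l addr0 dpair_act_r // peval_mul //.
have [s1 u1] : q1.1 = gv (sigma h) /\ [seq outgerm s t rel b | b <- q1.2] = v by case: E1.
have [s2 u2] : q2.1 = i /\ [seq outgerm s t rel b | b <- q2.2] = u by case: E2.
(* Rotated to start at [h], the cycle must continue with the maximal path that [h] closes up. *)
have Ec : is_cyc (u ++ h :: v) = (q1.2 ++ q2.2 == (mpath h).2).
  apply/idP/eqP => [/is_cyc_rot|E].
    rewrite cat_cons => /is_cyc_cons[_]; rewrite (cyc_mpath Eh) -u1 -u2 -map_cat => -[].
    exact: (inj_map (@outgerm_inj _ _ s t rel)).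
  apply: (@is_cyc_rot (h :: v)); apply/is_cycP; exists h => //.
  by rewrite (cyc_mpath Eh) -E map_cat u1 u2.
case: eqP => [Et|nt].
  rewrite dual_pathE ?Ec ?s1 ?xpair_eqE ?eqxx //.
  by rewrite -s1 pvalid_cat -!surjective_pairing v1 Et -surjective_pairing.
(* If [v] and [u] do not compose, the path is not closed and cannot be a cycle. *)
rewrite dpair0r; case C : (is_cyc _) => //; case: nt.
have := is_cyc_closed C vw; rewrite s2 -ptarget_lift E1.
by rewrite (@ptarget_cat BQ).
Qed.

Lemma form_peB_mul w w' : pvalid w -> pvalid w' ->
  form (fd_mul T (peB w) (peB w')) =
  ((ptarget w == w'.1) && is_cyc (w.2 ++ w'.2))%:R.
Proof.
move=> vw vw'; rewrite (peval_mul algT idemB arrB vw vw').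
case: eqP => [E|_]; last by rewrite triv_form0.
rewrite form_peB // (@pvalid_cat BQ) -surjective_pairing vw E.
by rewrite -surjective_pairing.
Qed.

(** * Complements in cycles and surjectivity *)

Lemma pvalid_traject h n : ~~ btrunc (G := Gam) h ->
  pvalid (Q := BQ) (gv h, traject sigma h n).
Proof.
elim: n h => [|n IH] h nh //; rewrite trajectS (@pvalid_cons BQ) eqxx /= nh /=.
by apply: IH; rewrite btrunc_sigma.
Qed.

Lemma ptarget_traject h n :
  ptarget (Q := BQ) (gv h, traject sigma h n) = gv (iter n sigma h).
Proof. by elim: n h => [|n IH] h //; rewrite iterSr -IH. Qed.

Lemma is_cyc_cyc h : ~~ btrunc (G := Gam) h -> is_cyc (cyc h).
Proof. by move=> nh; apply/is_cycP; exists h. Qed.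

(** [w] is the rest of a full cycle that begins with [p]; it serves as a preimage of the element of
    [D(A)] dual to [p], up to an element of [A]. *)
Lemma lift_complement p : pvalid p -> ~~ hrel p ->
  exists w : qpath BQ, [/\ pvalid w, ptarget w = p.1 &
    forall q, q.1 = p.1 -> is_cyc (w.2 ++ (lift q).2) = (q == p)].
Proof.
move=> vp np.
have [h [nh Eh [l El]]] : exists h, [/\ ~~ btrunc (G := Gam) h, gv h = p.1 &
    exists l, (lift p).2 = traject sigma h l].
  case: p vp np => i [|b bs] vp np.
    by have [h Eh nh] := nontrivial_germ has_arrow connQ admQ i; exists h; split=> //; exists 0%N.
  exists (outgerm s t rel b); split; first by rewrite btrunc_outgerm.
    by move: vp; rewrite pvalid_cons => /and3P[/eqP].
  by exists (size bs).+1; apply: lift_traject vp np.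
(* A lift contains no closing arrow, hence no full cycle. So the complement is nonempty, and its
   first arrow fixes what follows it. *)
have ltl : (l < order sigma h)%N.
  rewrite ltnNge; apply/negP => /(traject_order_ge sinj) E.
  have := is_cyc_end (is_cyc_cyc nh); apply/negP; apply/hasPn => g gh.
  have : g \in (lift p).2 by rewrite El E mem_cat gh.
  by case/mapP => b _ ->.
pose g := iter l sigma h; pose n := (order sigma h - l)%N.
have Ec : cyc h = (lift p).2 ++ traject sigma g n.
  by rewrite El -trajectD subnKC // ltnW.
have n0 : (0 < n)%N by rewrite subn_gt0.
exists (gv g, traject sigma g n); split=> [||q Eq].
- by apply: pvalid_traject; rewrite btrunc_iter.
- by rewrite ptarget_traject -iterD subnK 1?ltnW // iter_order.
have : is_cyc (traject sigma g n ++ (lift p).2).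
  by apply: is_cyc_rot; rewrite -Ec; apply: is_cyc_cyc.
rewrite -(prednK n0) trajectS !cat_cons => C.
apply/idP/eqP => [C'|-> //]; have [_ E] := is_cyc_cons C; have [_ E'] := is_cyc_cons C'.
apply: lift_inj; move: E'; rewrite -E => -[/eqP]; rewrite eqseq_cat // => /andP[_ /eqP Ew].
by rewrite /lift Eq Ew.
Qed.

Local Notation ceB := (ceval (A := T) (Q := BQ) eB xB).

Lemma spanB y : exists c : combo BQ k, cvalid c /\ ceB c = y.
Proof.
pose P (z : 'rV[k]_(d + d)) := exists c : combo BQ k, cvalid c /\ ceB c = z.
have PD z z' : P z -> P z' -> P (z + z').
  move=> [c [vc <-]] [c' [vc' <-]]; exists (c ++ c'); rewrite ceval_cat; split=> //.
  by rewrite /cvalid all_cat; apply/andP.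
have PZ l z : P z -> P (l *: z).
  move=> [c [vc <-]]; exists (scale_combo l c); rewrite ceval_scale; split=> //.
  by rewrite /cvalid all_map.
have P0 : P 0 by exists [::]; rewrite /ceval big_nil.
have Psum (I : eqType) (r : seq I) F : (forall i, i \in r -> P (F i)) -> P (\sum_(i <- r) F i).
  by move=> H; rewrite big_seq; elim/big_ind: _.
have Pl a : P (row_mx a 0).
  rewrite [a]row_sum_delta row_mx_suml.
  apply: (Psum) => j _; apply: (PZ); have [vj <-] := cbP j.
  rewrite /ceval row_mx_suml; apply: Psum => z zj; apply: PZ; exists [:: (1, lift z.2)].
  have vz : pvalid z.2 by apply: (allP vj).
  by rewrite ceval1 scale1r peB_lift // /cvalid /= pvalid_lift vz.
have Pd p : pvalid p -> ~~ hrel p -> P (row_mx 0 (dual_path p)).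
  move=> vp np; have [w [vw tw Hw]] := lift_complement vp np.
  have [a [f E]] := TExt_split (peB w).
  have -> : dual_path p = f.
    apply: dual_eq => q vq; rewrite dual_pathE //.
    have := form_peB_mul vw (etrans (pvalid_lift q) vq).
    rewrite E peB_lift // triv_form_mul // dpair0l add0r => ->.
    rewrite tw -[(lift q).1]/q.1; case: (p.1 =P q.1) => /= [Eq|nq]; first by rewrite -Hw.
    by case: eqP => // Eq; case: nq; rewrite Eq.
  (* The component in [A], whatever it is, already lies in the image. *)
  have -> : row_mx 0 f = peB w + (-1) *: row_mx a 0 :> 'rV[k]_(d + d).
    by rewrite E scale_row_mx scaler0 scaleN1r add_row_mx addr0 subrr.
  apply: PD; last by apply: PZ.
  by exists [:: (1, w)]; rewrite ceval1 scale1r /cvalid /= vw.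
have [a [f ->]] := TExt_split y.
have -> : row_mx a f = row_mx a 0 + row_mx 0 f by rewrite add_row_mx addr0 add0r.
apply: PD => //; rewrite [f]dual_expand row_mx_sumr.
by apply: Psum => p /basis_pathsP[vp np]; apply: PZ; apply: Pd.
Qed.

Lemma nondegB z : (forall w, pvalid w -> form (fd_mul T z (peB w)) = 0) -> z = 0.
Proof.
move=> H; apply: (triv_form_nondeg algA) => w; have [c [vc <-]] := spanB w.
rewrite /ceval (fd_mul_sumr algT) triv_form_sum big_seq big1 // => y yc.
by rewrite (fd_mulZr algT) triv_formZ H ?mulr0 //; apply: (allP vc).
Qed.

(** * The Brauer relations hold in the trivial extension *)

Local Notation brel := (brels Gam k).

Lemma bcycpow_cyc h : bcycpow (G := Gam) h = cyc h.
Proof. by rewrite /bcycpow /= cats0. Qed.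

Lemma is_cyc_cat_nil h v : is_cyc (cyc h ++ v) -> v = [::].
Proof.
rewrite {1}cyc_cons cat_cons => /is_cyc_cons[_]; rewrite -cat_cons -cyc_cons.
by move/(congr1 size)/eqP; rewrite size_cat -{2}[size _]addn0 eqn_add2l size_eq0 => /eqP.
Qed.

Lemma peB_eq0 (w : qpath BQ) : pvalid w -> (forall v, ~~ is_cyc (w.2 ++ v)) -> peB w = 0.
Proof.
move=> vw H; apply: nondegB => w' vw'.
by rewrite form_peB_mul // (negPf (H _)) andbF.
Qed.

Lemma cyc_cons2 h : ~~ btrunc (G := Gam) h -> exists v, cyc h = [:: h, sigma h & v].
Proof.
move=> nh; rewrite cyc_cons; case E : (order sigma h).-1 => [|n]; last by eexists.
case/negP: nh; rewrite /btrunc /= andbT; have := iter_order sinj h.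
by rewrite -orderSpred E /= => ->.
Qed.

Lemma cyc_rcons h : exists v, exists2 g, cyc h = rcons v g & sigma g = h.
Proof.
exists (traject sigma h (order sigma h).-1), (iter (order sigma h).-1 sigma h).
  by rewrite -trajectSr orderSpred.
by rewrite -iterS orderSpred iter_order.
Qed.

Lemma rel_commut h1 h2 : h1 != h2 -> gv h1 = gv h2 -> ~~ btrunc (G := Gam) h1 ->
  ~~ btrunc (G := Gam) h2 -> [:: (1, (gv h1, cyc h1)); (-1, (gv h2, cyc h2))] \in brel.
Proof.
move=> ne E n1 n2; rewrite !mem_cat; apply/or3P; constructor 1.
apply/mapP; exists (h1, h2); last by rewrite !bcycpow_cyc.
by rewrite mem_enum inE /= ne E n1 n2 eqxx.
Qed.

Lemma rel_leaf h1 h2 : h1 != h2 -> gv h1 = gv h2 -> btrunc (G := Gam) h1 ->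
  ~~ btrunc (G := Gam) h2 -> [:: (1, (gv h2, cyc h2 ++ [:: h2]))] \in brel.
Proof.
move=> ne E n1 n2; rewrite !mem_cat; apply/or3P; constructor 2.
apply/mapP; exists (h1, h2); last by rewrite !bcycpow_cyc.
by rewrite mem_enum inE /= ne E n1 n2 eqxx.
Qed.

Lemma rel_zero h1 h2 : h2 != sigma h1 -> gv (sigma h1) = gv h2 -> ~~ btrunc (G := Gam) h1 ->
  ~~ btrunc (G := Gam) h2 -> [:: (1, (gv h1, [:: h1; h2]))] \in brel.
Proof.
move=> ne E n1 n2; rewrite !mem_cat; apply/or3P; constructor 3.
apply/mapP; exists (h1, h2); last by [].
by rewrite mem_enum inE /= ne E n1 n2 eqxx.
Qed.

Lemma brel_sound r : r \in brel -> cvalid r /\ ceB r = 0.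
Proof.
rewrite !mem_cat => /or3P[] /mapP[[h1 h2]]; rewrite mem_enum inE /=.
- case/and4P=> ne /eqP E n1 n2 ->; rewrite !bcycpow_cyc.
  have v1 := pvalid_traject (order sigma h1) n1; have v2 := pvalid_traject (order sigma h2) n2.
  split; first by rewrite /cvalid /= v1 v2.
  apply: nondegB => w vw; rewrite -cat1s ceval_cat !ceval1 scale1r.
  rewrite (fd_mulDl algT) (fd_mulZl algT) triv_formD triv_formZ !form_peB_mul //.
  rewrite !cyc_closed -/(gv h1) -/(gv h2) E /=.
  (* A full cycle pairs to 1 with the trivial path at its vertex only; this does not depend on which
     of the two cycles is taken. *)
  suff H h : ~~ btrunc (G := Gam) h -> is_cyc (cyc h ++ w.2) = (w.2 == [::]).
    by rewrite !H // mulN1r subrr.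
  move=> nh; apply/idP/eqP => [/is_cyc_cat_nil //|->].
  by rewrite cats0; apply: is_cyc_cyc.
- case/and4P=> ne /eqP E n1 n2 ->; rewrite !bcycpow_cyc.
  have v2 : pvalid (Q := BQ) (gv h2, cyc h2 ++ [:: h2]).
    rewrite (@pvalid_cat BQ) cyc_closed (pvalid_traject _ n2).
    by rewrite (@pvalid_cons BQ) eqxx /= n2.
  split; first by rewrite /cvalid /= v2.
  rewrite ceval1 scale1r; apply: peB_eq0 => // v; apply/negP.
  by rewrite -catA => /is_cyc_cat_nil.
case/and4P=> n1 n2 /eqP E ne ->.
have v2 : pvalid (Q := BQ) (gv h1, [:: h1; h2]).
  by rewrite !(@pvalid_cons BQ) /= n1 n2 E !eqxx.
split; first by rewrite /cvalid /= v2.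
rewrite ceval1 scale1r; apply: peB_eq0 => // v; apply/negP => /is_cyc_cons[_].
by have [v' ->] := cyc_cons2 n1; case=> E2 _; rewrite E2 eqxx in ne.
Qed.

(** * Paths that vanish modulo the Brauer relations *)

Lemma in_ideal_nonsucc i (u : seq germ) h1 h2 v : h2 != sigma h1 ->
  pvalid (Q := BQ) (i, u ++ h1 :: h2 :: v) -> in_ideal brel [:: (1, (i, u ++ h1 :: h2 :: v))].
Proof.
move=> ne vw; have [vu tu n1] := pvalidB_mid vw.
rewrite (@pvalid_cons BQ) => /and3P[/eqP E n2 _].
by apply: (@in_ideal_monomial BQ k _ i u (gv h1, [:: h1; h2]) v) => //; apply: rel_zero.
Qed.

(** If the other half-edge [h'] at the vertex is truncated, this is the leaf relation. Otherwise
    [cyc h] is replaced by [cyc h'], whose last arrow is followed by [h'] and not by [h]. *)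
Lemma in_ideal_overlong h v : ~~ btrunc (G := Gam) h ->
  pvalid (Q := BQ) (gv h, cyc h ++ h :: v) -> in_ideal brel [:: (1, (gv h, cyc h ++ h :: v))].
Proof.
move=> nh vw; have [h' Eh ne] := other_germ has_arrow connQ admQ h.
case: (boolP (btrunc (G := Gam) h')) => T'.
  have -> : cyc h ++ h :: v = [::] ++ (cyc h ++ [:: h]) ++ v by rewrite -catA.
  apply: (@in_ideal_monomial BQ k _ (gv h) [::] (gv h, cyc h ++ [:: h]) v) => //.
    exact: rel_leaf ne Eh T' nh.
  by rewrite -catA.
have vhv : pvalid (Q := BQ) (gv h, h :: v).
  by move: vw; rewrite (@pvalid_cat BQ) cyc_closed => /andP[].
have ne' : h != h' by rewrite eq_sym.
have rr := rel_commut ne' (esym Eh) nh T'.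
have := @in_ideal_gen BQ k _ _ (gv h, [::]) (gv h, h :: v) isT vhv rr.
rewrite !mul_pcp_cons !cyc_closed /= Eh !eqxx /= => I1.
have I2 : in_ideal brel [:: (1, (gv h, cyc h' ++ h :: v))].
  have [u [g Ec Eg]] := cyc_rcons h'; rewrite Ec cat_rcons; apply: in_ideal_nonsucc.
    by rewrite Eg eq_sym.
  rewrite -cat_rcons -Ec (@pvalid_cat BQ) -Eh cyc_closed.
  by rewrite (pvalid_traject _ T') Eh vhv.
apply: in_ideal_eq (in_ideal_cat I1 I2) => p.
rewrite /coef !big_cons !big_nil /=.
by case: ((_, cyc h' ++ _) == p); rewrite ?addr0 ?addNr ?addr0.
Qed.

(** Prefixes suffice to describe subpaths of cycles, because rotations of cycles are cycles. *)
Definition is_sub (ys : seq germ) : bool :=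
  [exists h, ~~ btrunc (G := Gam) h && prefix ys (cyc h)].

Lemma is_subP ys : reflect (exists v, is_cyc (ys ++ v)) (is_sub ys).
Proof.
apply: (iffP existsP) => [[h /andP[nh /prefixP[v E]]]|[v /is_cycP[h nh E]]].
  by exists v; rewrite -E is_cyc_cyc.
by exists h; rewrite nh -E prefix_prefix.
Qed.

(** Such a path either has two neighbouring arrows that are not successive or runs along [sigma]
    beyond a full cycle. *)
Lemma in_ideal_nonsub (w : qpath BQ) : pvalid w -> ~~ is_sub w.2 -> in_ideal brel [:: (1, w)].
Proof.
case: w => i [|h ys] vw /= nsub.
  have [h _ nh] := nontrivial_germ has_arrow connQ admQ i.
  by case/is_subP: nsub; exists (cyc h); apply: is_cyc_cyc.
have := vw; rewrite (@pvalid_cons BQ) => /and3P[/eqP Eh nh _]; rewrite -Eh in vw *.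
case: (boolP (fpath sigma h ys)) => [/fpathE E|]; last first.
  move=> np; have [u [h1 [h2 [v [E ne]]]]] := not_path_split np; rewrite E in vw *.
  by apply: in_ideal_nonsucc vw; rewrite eq_sym.
have {}E : h :: ys = traject sigma h (size ys).+1 by rewrite /= -E.
case: (leqP (size ys).+1 (order sigma h)) => le.
  case/existsP: nsub; exists h; apply/andP; split=> //.
  by rewrite prefixE E size_traject take_traject.
have := traject_order_ge sinj (ltnW le); rewrite -E.
case: (_ - _)%N (subn_gt0 (order sigma h) (size ys).+1) => [|n]; first by rewrite le.
by rewrite trajectS => _ E'; rewrite E' in vw *; apply: in_ideal_overlong.
Qed.

Lemma is_sub_extend (w : qpath BQ) : pvalid w -> is_sub w.2 ->
  exists v, is_cyc (w.2 ++ v) /\ pvalid (w.1, w.2 ++ v).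
Proof.
case: w => i [|h ys] vw /=.
  have [h <- nh] := nontrivial_germ has_arrow connQ admQ i.
  by exists (cyc h); rewrite is_cyc_cyc // pvalid_traject.
case/is_subP=> v C; exists v; split=> //; have [nh ->] := is_cyc_cons C.
by move: vw; rewrite (@pvalid_cons BQ) => /and3P[/eqP <- _ _]; apply: pvalid_traject.
Qed.

Lemma zero_pathP (w : qpath BQ) : pvalid w -> zero_path brel w <-> ~~ is_sub w.2.
Proof.
move=> vw; split=> [|/(in_ideal_nonsub vw)//].
move/(ceval_in_ideal algT idemB arrB brel_sound); rewrite ceval1 scale1r => E.
(* Completed to a full cycle, a zero image would have value 1 under the form. *)
apply/negP => /(is_sub_extend vw)[v [C]]; rewrite (@pvalid_cat BQ) -surjective_pairing.
case/andP=> _ vv; have := form_peB_mul vw vv.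
by rewrite E (fd_mul0l algT) triv_form0 eqxx /= C => /eqP; rewrite eq_sym oner_eq0.
Qed.

(** * Normal forms and completeness of the relations *)

Definition vertex_cyc (i : V) : option (seq germ) :=
  omap (fun h => cyc h) [pick h : germ | ~~ btrunc (G := Gam) h & gv h == i].

(** [None] stands for zero. The full cycles at a vertex agree modulo the relations, so the chosen
    one, [vertex_cyc], represents them all. *)
Definition nform (w : qpath BQ) : option (qpath BQ) :=
  if ~~ is_sub w.2 then None
  else if is_cyc w.2 then omap (pair w.1) (vertex_cyc w.1) else Some w.

Definition normal (w : qpath BQ) : bool :=
  [&& pvalid w, is_sub w.2 & is_cyc w.2 ==> (vertex_cyc w.1 == Some w.2)].

Definition nterm (l : k) (w : qpath BQ) : combo BQ k :=
  if nform w is Some w' then [:: (l, w')] else [::].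

Lemma vertex_cycP i : exists h, [/\ vertex_cyc i = Some (cyc h), ~~ btrunc (G := Gam) h & gv h = i].
Proof.
rewrite /vertex_cyc; case: pickP => [h /andP[nh /eqP Eh]|H]; first by exists h.
have [h Eh nh] := nontrivial_germ has_arrow connQ admQ i.
by have := H h; rewrite Eh eqxx nh.
Qed.

Lemma nform_normal w w' : pvalid w -> nform w = Some w' -> normal w'.
Proof.
rewrite /nform => vw; case: (boolP (is_sub w.2)) => //= sw.
case: ifP => [_|nc [<-]]; last by rewrite /normal vw sw nc.
have [h [E nh Eh]] := vertex_cycP w.1; rewrite E => -[<-].
rewrite /normal /= E eqxx implybT andbT -Eh pvalid_traject //=.
by apply/is_subP; exists [::]; rewrite cats0 is_cyc_cyc.
Qed.

Lemma in_ideal_nform w : pvalid w -> in_ideal brel ((1, w) :: nterm (-1) w).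
Proof.
rewrite /nterm /nform => vw; case: (boolP (is_sub w.2)) => /= [sw|]; last exact: in_ideal_nonsub.
case: ifP => [C|_]; last first.
  by apply: in_ideal0 => p; rewrite /coef !big_cons big_nil /=; case: eqP; rewrite ?addr0 ?subrr.
have [h [E nh Eh]] := vertex_cycP w.1; rewrite E /=.
case: w vw C E Eh {sw} => i ys /= vw C E Eh; case/is_cycP: C vw => h' nh' ->.
rewrite {1}cyc_cons (@pvalid_cons BQ) => /and3P[/eqP Eh' _ _].
have {}Eh' : gv h' = i := Eh'; rewrite -{2}Eh -Eh'.
case: (h' =P h) => [->|/eqP ne].
  by apply: in_ideal0 => p; rewrite /coef !big_cons big_nil /=; case: eqP; rewrite ?addr0 ?subrr.
have rr := rel_commut ne (etrans Eh' (esym Eh)) nh' nh.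
have := @in_ideal_gen BQ k _ _ (gv h', [::]) (gv h', [::]) isT isT rr.
by rewrite !mul_pcp_cons !cyc_closed /= Eh' Eh !eqxx /= !cats0.
Qed.

(** A dual family for the form, from which independence of the normal paths follows: a full cycle is
    paired with the trivial path at its vertex, any other normal path with its complement. *)
Lemma normal_dual p : normal p -> exists2 u : qpath BQ, pvalid u &
  forall q, normal q -> ((ptarget q == u.1) && is_cyc (q.2 ++ u.2)) = (q == p).
Proof.
case/and3P=> vp sp cp; case: (boolP (is_cyc p.2)) => Cp.
  exists (p.1, [::]) => // q /and3P[vq _ cq]; rewrite /= cats0.
  have closed (r : qpath BQ) : pvalid r -> is_cyc r.2 -> ptarget r = r.1.
    by case: r => j ys vr C; apply: is_cyc_closed.
  apply/andP/eqP => [[/eqP tq Cq]|->]; last by rewrite closed.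
  rewrite closed // in tq; rewrite Cq /= in cq; rewrite Cp /= in cp.
  move: cq; rewrite tq (eqP cp) => /eqP[Es].
  by rewrite [p]surjective_pairing [q]surjective_pairing tq Es.
have [v [C vv]] := is_sub_extend vp sp.
exists (ptarget p, v).
  by move: vv; rewrite (@pvalid_cat BQ) -surjective_pairing => /andP[].
move=> q /and3P[vq _ _] /=; apply/andP/eqP => [[/eqP tq Cq]|->]; last by rewrite eqxx.
have vvq : pvalid (Q := BQ) (q.1, q.2 ++ v).
  rewrite (@pvalid_cat BQ) -surjective_pairing vq tq.
  by move: vv; rewrite (@pvalid_cat BQ) -surjective_pairing => /andP[].
have E1 : q.1 = p.1.
  rewrite -(is_cyc_closed C vv) -(is_cyc_closed Cq vvq) !(@ptarget_cat BQ).
  by rewrite -!surjective_pairing tq.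
case: v C Cq {vv vvq} => [|h v]; first by rewrite cats0 (negPf Cp).
move=> /is_cyc_rot C /is_cyc_rot Cq; rewrite !cat_cons in C Cq.
have [_ E] := is_cyc_cons C; have [_] := is_cyc_cons Cq; rewrite -E => -[/eqP].
rewrite eqseq_cat // => /andP[_ /eqP E2].
by rewrite [p]surjective_pairing [q]surjective_pairing E1 E2.
Qed.

Lemma normal_indep (c : combo BQ k) : (forall z, z \in c -> normal z.2) ->
  ceB c = 0 -> forall p, coef c p = 0.
Proof.
move=> nc E p; rewrite /coef; case: (boolP (normal p)) => np; last first.
  rewrite big_seq_cond big_pred0 // => z; apply/andP => -[/nc nz /eqP Ez].
  by rewrite -Ez nz in np.
have [u vu Hu] := normal_dual np; have := triv_form0 A.
rewrite -(fd_mul0l algT (peB u)) -E /ceval (fd_mul_suml algT) triv_form_sum => S0.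
apply: etrans S0; rewrite big_mkcond big_seq [RHS]big_seq; apply: eq_bigr => z /nc nz.
have /and3P[vz _ _] := nz; rewrite (fd_mulZl algT) triv_formZ form_peB_mul // Hu //.
by case: eqP; rewrite ?mulr1 ?mulr0.
Qed.

Lemma brel_complete (c : combo BQ k) : cvalid c -> ceB c = 0 -> in_ideal brel c.
Proof.
move=> vc E; pose c' := flatten [seq nterm z.1 z.2 | z <- c].
(* Modulo the ideal [c] equals its normal form [c'], which is then also in the kernel and has zero
   coefficients by independence. *)
have I : in_ideal brel (c ++ scale_combo (-1) c').
  rewrite {}/c' {E}; elim: c vc => [_|[l w] c IH /andP[vw vc]].
    by apply: in_ideal0 => p; rewrite /coef big_nil.
  apply: in_ideal_eq (in_ideal_cat (in_ideal_scale l (in_ideal_nform vw)) (IH vc)) => p.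
  rewrite -[flatten (map _ (_ :: _))]/(nterm l w ++ flatten [seq nterm z.1 z.2 | z <- c]).
  rewrite !(combo_coef_cat, combo_coef_scale, combo_coef_cons) !mulrDr.
  rewrite [RHS]addrACA /=; congr (_ + _ + _).
    by case: eqP; rewrite ?mulr1 ?mulr0.
  rewrite /nterm; case: (nform w) => [w'|]; last by rewrite /coef big_nil !mulr0.
  by rewrite !combo_coef1; case: eqP; rewrite ?mulrN1 ?mulN1r ?mulr0 ?oppr0.
have nc' z : z \in c' -> normal z.2.
  case/flatten_mapP=> y yc; rewrite /nterm; case Ey : (nform y.2) => [w|] //.
  by rewrite inE => /eqP ->; apply: nform_normal Ey; apply: (allP vc).
have E' : ceB c' = 0.
  have := ceval_in_ideal algT idemB arrB brel_sound I.
  by rewrite ceval_cat ceval_scale E add0r scaleN1r => /eqP; rewrite oppr_eq0 => /eqP.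
apply: in_ideal_eq I => p.
by rewrite combo_coef_cat combo_coef_scale (normal_indep nc' E') mulr0 addr0.
Qed.

Lemma presents_TExt : presents T brel.
Proof.
exists eB, xB; split; first exact: idemB.
split; first exact: sumB.
split; first exact: arrB.
split; first exact: spanB.
move=> c vc; split; first exact: brel_complete.
exact: (ceval_in_ideal algT idemB arrB brel_sound).
Qed.

(** * Maximal cyclic paths and the graph of the trivial extension *)

Lemma maxcyc_cyc h : ~~ btrunc (G := Gam) h -> maxcyc brel (gv h) (gv h, cyc h).
Proof.
move=> nh; have vc := pvalid_traject (order sigma h) nh; split; [split|split] => //=.
- by rewrite cyc_cons.
- exact: cyc_closed.
- move/(zero_pathP vc)/negP; apply; apply/is_subP; exists [::].
  by rewrite cats0 is_cyc_cyc.
- move=> a na Ea; apply/zero_pathP.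
    rewrite (@pvalid_cat BQ) vc cyc_closed (@pvalid_cons BQ) andTb.
    by apply/and3P; split=> //; apply/eqP.
  by apply/is_subP => -[v]; rewrite -catA => /is_cyc_cat_nil.
move=> a na Ea; apply/zero_pathP.
  by rewrite (@pvalid_cons BQ) eqxx (Ea : qt (q := BQ) a = gv h) andTb; apply/andP.
apply/is_subP => -[v] /= /is_cyc_cons[_ E].
have Eh : h = sigma a.
  by have [v' E'] := cyc_cons2 na; move: E; rewrite E' cyc_cons => -[].
(* [cyc a] would contain one arrow more than [cyc h], although [a] and [h] lie on the same orbit. *)
have := congr1 size E; rewrite Eh /= size_cat !size_orbit.
by rewrite (order_iter_inj sinj 1) => /eqP; rewrite eqn_leq ltnNge leq_addr.
Qed.

Lemma maxcycP i c : maxcyc brel i c ->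
  exists h, [/\ ~~ btrunc (G := Gam) h, gv h = i & c = (gv h, cyc h)].
Proof.
case: c => j ys [[/= -> ne vc tc nz] [mr _]].
have sc : is_sub ys.
  by case: (boolP (is_sub ys)) => // H; case: nz; apply/(zero_pathP vc).
(* If the completion to a cycle begins with an arrow [a], extending by [a] gives a nonzero path,
   against maximality. *)
have [[|a v] [/= C vv]] := is_sub_extend vc sc; last first.
  have [_ Ea na _] := pvalidB_mid vv; rewrite tc in Ea.
  have va : pvalid (Q := BQ) (i, ys ++ [:: a]).
    rewrite (@pvalid_cat BQ) vc tc (@pvalid_cons BQ) andTb.
    by apply/and3P; split=> //; apply/eqP.
  have /(zero_pathP va)/negP[] := mr a na (esym Ea); apply/is_subP; exists v.
  by rewrite -catA.
rewrite cats0 in C; case/is_cycP: C vc => h nh ->.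
rewrite {1}cyc_cons (@pvalid_cons BQ) => /and3P[/eqP Eh _ _].
by exists h; rewrite -Eh.
Qed.

Lemma G_equals_GammaA : G_equals brel.
Proof.
(* The orbit of a truncated germ is a single loop that is no arrow; its counterpart is the trivial
   path next to a unique maximal cyclic path. *)
pose f (h : germ) : qpath BQ := (gv h, if btrunc (G := Gam) h then [::] else cyc h).
exists f; split.
- move=> h h'; rewrite /f.
  case: (boolP (btrunc (G := Gam) h)) => T1; case: (boolP (btrunc (G := Gam) h')) => T2 [Ev].
  + move: T1 T2; rewrite !btrunc_germ // => /andP[/eqP i1 /eqP o1] /andP[/eqP i2 /eqP o2].
    by apply: germ_eq; rewrite ?i1 ?i2 ?o1 ?o2.
  + by rewrite cyc_cons.
  + by rewrite cyc_cons.
  + by rewrite (cyc_cons h) (cyc_cons h') => -[].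
- move=> h; split=> //; rewrite /f; case: ifP => [T1|/negbT nh]; last first.
    by left; apply: maxcyc_cyc.
  right; split=> //; have [h' Eh nh] := nontrivial_germ has_arrow connQ admQ (gv h).
  exists (gv h, cyc h'); split; first by have := maxcyc_cyc nh; rewrite Eh.
  move=> q /maxcycP[g [ng Eg ->]].
  by rewrite (nontrivial_germ_uniq gentleQ admQ T1 Eg Eh ng nh) Eh.
- move=> i c [/maxcycP[h [nh Eh ->]]|[-> [p [mp up]]]].
    by exists h; rewrite /f (negPf nh).
  (* The second germ [h'] is truncated, for otherwise [cyc h'] would be another maximal cyclic path
     at [i]. *)
  have [h [nh Eh Ep]] := maxcycP mp; have [h' Eh' ne] := other_germ has_arrow connQ admQ h.
  exists h'; rewrite /f Eh' Eh; case: ifP => // /negbT nh'; case/eqP: ne.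
  have /up : maxcyc brel i (gv h', cyc h') by rewrite -Eh -Eh'; apply: maxcyc_cyc.
  by rewrite Ep (cyc_cons h) (cyc_cons h') => -[].
- move=> h; rewrite /f /= btrunc_sigma //; case: ifP => [/andP[/eqP /= -> _] //|_].
  by rewrite /rot1 /= -rot1_orbit // cyc_cons rot1_cons cats1.
move=> h; rewrite /f /gmult /=; case: ifP => // _.
by move: (orbit_uniq sigma h); case: (cyc h) => // y ys uy; rewrite rperiod_uniq // divnn.
Qed.

End TrivialExtension.

Theorem theorem1p2 (k : closedFieldType) (V Arr : finType) (s t : Arr -> V)
  (rel : Arr -> Arr -> bool) (A : fdalg k) :
  (exists a : Arr, True) ->
  qconnected (gquiver s t) ->
  gentle s t rel ->
  admissible s t rel ->
  is_fdalg A ->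
  presents A (gentle_rels s t rel k) ->
  presents (TExt A) (brels (GammaA s t rel) k) /\
  G_equals (brels (GammaA s t rel) k).
Proof.
move=> has_arrow connQ gentleQ admQ algA [e [x [idemA [sumA [arrA [spanA kerA]]]]]].
have [cb cbP] := fin_all_exists (fun i => spanA (delta_mx ord0 i)).
by split; [apply: (presents_TExt _ _ _ _ _ idemA sumA arrA kerA cbP)
         | apply: (G_equals_GammaA _ _ _ _ _ idemA arrA kerA cbP)].
Qed.
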